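(* Let $G$ be a Lie group (in Milnor's sense, modeled over a Hausdorff locally convex vector space) whose Lie algebra $(\mathfrak g,[\cdot,\cdot])$ is submultiplicative. Then $G$ is $k$-confined for each $k\in\mathbb N\sqcup\{\mathrm{lip},\infty\}$. Moreover, $G$ is reliable, as it fulfills the following condition: for each $\mathfrak v\in\mathfrak P$ there exist $\mathfrak w\in\mathfrak P$ with $\mathfrak v\le\mathfrak w$, $C\ge0$, and $V\subseteq G$ open with $e\in V$ such that $\dot{\mathfrak w}\circ\mathrm{Ad}_g\le C\cdot\dot{\mathfrak w}$ for all $g\in V$.
   Context: Calculus: for Hausdorff locally convex vector spaces $F,E$ and $U\subseteq F$ open, a map $f:U\to E$ is differentiable at $x$ if $D_vf(x)=\lim_{t\to 0}\frac1t(f(x+tv)-f(x))$ exists in $E$ for every $v\in F$; it is $C^0$ if continuous, $C^k$ ($k\ge 1$) if all iterated directional derivatives $D_{v_p}\cdots D_{v_1}f$ ($p\le k$) exist and $(x,v_1,\dots,v_p)\mapsto D_{v_p}\cdots D_{v_1}f(x)$ is continuous on $U\times F^p$ for $0\le p\le k$; $C^\infty$ (smooth) if $C^k$ for all $k$. $G$ is a Lie group in Milnor's sense: a group that is a smooth Hausdorff manifold (in this calculus) modeled on a Hausdorff locally convex vector space $E$, with smooth multiplication and inversion. $e$ is the unit, $\mathfrak g=T_eG$ the Lie algebra with bracket $[\cdot,\cdot]$, $\mathrm R_g(h)=hg$, $\mathrm{Ad}_g=d_e(h\mapsto ghg^{-1})$. $\mathfrak P$ is the set of continuous seminorms on $E$.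 $\Xi:G\supseteq\mathcal U\to\mathcal V\subseteq E$ is a fixed chart with $e\in\mathcal U$, $\Xi(e)=0$, $\mathcal V$ convex. For $\mathfrak p\in\mathfrak P$ put $\dot{\mathfrak p}:=\mathfrak p\circ d_e\Xi$; these seminorms define the topology of $\mathfrak g$. $(\mathfrak g,[\cdot,\cdot])$ is submultiplicative if for each $\mathfrak v\in\mathfrak P$ there exists $\mathfrak w\in\mathfrak P$ with $\mathfrak v\le\mathfrak w$ such that $\dot{\mathfrak w}([X,Y])\le\dot{\mathfrak w}(X)\,\dot{\mathfrak w}(Y)$ for all $X,Y\in\mathfrak g$. $G$ is reliable if for each $\mathfrak v\in\mathfrak P$ there exist a symmetric neighbourhood $V\subseteq G$ of $e$ and a sequence $\{\mathfrak w_n\}_{n\ge1}\subseteq\mathfrak P$ with $\dot{\mathfrak v}\circ\mathrm{Ad}_{g_1}\circ\dots\circ\mathrm{Ad}_{g_n}\le\dot{\mathfrak w}_n$ for all $g_1,\dots,g_n\in V$, $n\ge1$. A curve on $[r,r']$ ($r<r'$) is $C^k$, $k\in\mathbb N\sqcup\{\infty\}$, if it is the restriction of a $C^k$-curve on an open interval containing $[r,r']$; $C^{\mathrm{lip}}([r,r'],\mathfrak g)$ is the set of curves $\phi$ such that for each $\mathfrak p\in\mathfrak P$ there is $L_{\mathfrak p}\ge0$ with $\dot{\mathfrak p}(\phi(t)-\phi(t'))\le L_{\mathfrak p}|t-t'|$ for all $t,t'$. The right logarithmic derivative of $\mu\in C^1([r,r'],G)$ is $\delta^r(\mu)(t)=d_{\mu(t)}\mathrm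 R_{\mu(t)^{-1}}(\dot\mu(t))$. Put $\mathfrak D_{[r,r']}:=\delta^r(C^1([r,r'],G))\subseteq C^0([r,r'],\mathfrak g)$. For $\phi=\delta^r(\mu)\in\mathfrak D_{[r,r']}$ the product integral is $\Pi_r^t\phi:=\mu(t)\mu(r)^{-1}$ (well defined). $\mathfrak DP^0([0,1],\mathfrak g)$ is the set of maps $\phi:[0,1]\to\mathfrak g$ for which there exist $0=t_0<\dots<t_n=1$ and $\phi[p]\in\mathfrak D_{[t_p,t_{p+1}]}$ with $\phi|_{(t_p,t_{p+1})}=\phi[p]|_{(t_p,t_{p+1})}$ for $p=0,\dots,n-1$; then $\Pi_0^0\phi:=e$ and $\Pi_0^t\phi:=\Pi_{t_p}^t\phi[p]\cdot\Pi_{t_{p-1}}^{t_p}\phi[p-1]\cdots\Pi_{t_0}^{t_1}\phi[0]$ for $t\in(t_p,t_{p+1}]$ (well defined). Write $\dot{\mathfrak p}_\infty(\phi)=\sup_{t\in[0,1]}\dot{\mathfrak p}(\phi(t))$. A sequence $\{\phi_n\}\subseteq\mathfrak DP^0([0,1],\mathfrak g)$ is tame if for each $\mathfrak v\in\mathfrak P$ there is $\mathfrak w\in\mathfrak P$, $\mathfrak v\le\mathfrak w$, with $\dot{\mathfrak v}\circ\mathrm{Ad}_{[\Pi_0^t\phi_n]^{-1}}\le\dot{\mathfrak w}$ for all $n\in\mathbb N$, $t\in[0,1]$. It is Cauchy if for all $\mathfrak p$, $\varepsilon>0$ there is $p$ with $\dot{\mathfrak p}_\infty(\phi_m-\phi_n)\le\varepsilon$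 for $m,n\ge p$; it is Mackey-Cauchy if there are $c_{\mathfrak p}\ge0$, $l_{\mathfrak p}\in\mathbb N$ ($\mathfrak p\in\mathfrak P$) and $0\le\lambda_{m,n}\to0$ (as $(m,n)\to\infty$) with $\dot{\mathfrak p}_\infty(\phi_m-\phi_n)\le c_{\mathfrak p}\lambda_{m,n}$ for all $m,n\ge l_{\mathfrak p}$, $\mathfrak p\in\mathfrak P$. A curve $\phi\in C^0([0,1],\mathfrak g)$ is $\mathfrak s$-integrable (resp. $\mathfrak m$-integrable) if there is a tame Cauchy (resp. tame Mackey-Cauchy) sequence in $\mathfrak DP^0([0,1],\mathfrak g)$ converging to $\phi$ uniformly (i.e. in all $\dot{\mathfrak p}_\infty$). $G$ is $0$-confined if each $\phi\in C^0([0,1],\mathfrak g)$ is $\mathfrak s$-integrable; for $k\in\mathbb N_{\ge1}\sqcup\{\mathrm{lip},\infty\}$, $G$ is $k$-confined if each $\phi\in C^k([0,1],\mathfrak g)$ is $\mathfrak m$-integrable. *)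

(* Defs.v *)
From HB Require Import structures.
From mathcomp Require Import all_boot all_order all_algebra.
From mathcomp Require Import all_classical all_reals all_analysis.

Set Implicit Arguments.
Unset Strict Implicit.
Unset Printing Implicit Defensive.

Import Order.TTheory GRing.Theory Num.Theory.
Import numFieldNormedType.Exports.

Local Open Scope classical_set_scope.
Local Open Scope ring_scope.

(** * Calculus in locally convex spaces *)

(* Functions are total, and only their values on an open set [U] are relevant.
   The library's ['D_v f] is restricted to normed modules, and does not apply
   to locally convex spaces. *)
Section Calculus.
Context {R : realType} {F E : tvsType R}.

Definition diff_quot (f : F -> E) (x v : F) (t : R) : E :=
  t^-1 *: (f (x + t *: v) - f x).

Definition is_dderive (f : F -> E) (x v : F) (l : E) : Prop :=
  diff_quot f x v t @[t --> (0 : R)^'] --> l.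

Definition dderivable (f : F -> E) (x v : F) : Prop :=
  exists l, is_dderive f x v l.

(* [lim] is not available, as the type [E] carries no canonical point *)
Definition dderive (f : F -> E) (x v : F) : E :=
  xget 0 [set l | is_dderive f x v l].

(* [iter_dderive f [:: v_1; ...; v_p] = D_{v_p} ... D_{v_1} f] *)
Definition iter_dderive (f : F -> E) (vs : seq F) : F -> E :=
  foldl (fun g v => dderive g ^~ v) f vs.

(* [p <= k], where [None] stands for [k = oo] *)
Definition le_order (p : nat) (k : option nat) : bool :=
  if k is Some m then (p <= m)%N else true.

Definition Ck_on (k : option nat) (U : set F) (f : F -> E) : Prop :=
  (forall (vs : seq F) (v x : F), le_order (size vs).+1 k -> U x ->
     dderivable (iter_dderive f vs) x v) /\
  (forall p : nat, le_order p k ->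
     forall (x : F) (v : {ptws 'I_p -> F}), U x ->
       {for (x, v), continuous (fun z : F * {ptws 'I_p -> F} =>
          iter_dderive f [seq z.2 i | i <- enum 'I_p] z.1)}).

End Calculus.

Record cont_seminorm (R : realType) (E : tvsType R) := ContSeminorm {
  seminorm_fun :> E -> R;
  seminormD : forall x y, seminorm_fun (x + y) <= seminorm_fun x + seminorm_fun y;
  seminormZ : forall (a : R) x, seminorm_fun (a *: x) = `|a| * seminorm_fun x;
  seminorm_continuous : continuous seminorm_fun }.

Definition seminorm_le (R : realType) (E : tvsType R)
    (v w : cont_seminorm E) : Prop := forall x, v x <= w x.

(** * Manifolds *)

Record chart (M E : Type) := Chart {
  cdom : set M;
  cfwd : M -> E;
  cbwd : E -> M }.

HB.instance Definition _ (M E : Type) := gen_eqMixin (chart M E).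
HB.instance Definition _ (M E : Type) := gen_choiceMixin (chart M E).

Definition cimg (M E : Type) (c : chart M E) : set E := cfwd c @` cdom c.

Definition prod_chart (M N F E : Type) (c : chart M F) (d : chart N E) :
    chart (M * N)%type (F * E)%type :=
  Chart (cdom c `*` cdom d)
        (fun z => (cfwd c z.1, cfwd d z.2))
        (fun z => (cbwd c z.1, cbwd d z.2)).

Definition prod_atlas (M N F E : Type) (A : set (chart M F))
    (B : set (chart N E)) : set (chart (M * N)%type (F * E)%type) :=
  [set cd | exists c d, [/\ A c, B d & cd = prod_chart c d]].

Definition line_atlas (R : realType) : set (chart R^o R^o) :=
  [set Chart setT id id].

Section Manifold.
Context {R : realType} {E : tvsType R} {M : topologicalType}.

Definition is_chart (c : chart M E) : Prop :=
  [/\ open (cdom c), open (cimg c),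
      (forall x, cdom c x -> cbwd c (cfwd c x) = x),
      (forall x, cdom c x -> {for x, continuous (cfwd c)}) &
      (forall y, cimg c y -> {for y, continuous (cbwd c)})].

Definition compatible (c d : chart M E) : Prop :=
  Ck_on None (cfwd c @` (cdom c `&` cdom d)) (cfwd d \o cbwd c) /\
  Ck_on None (cfwd d @` (cdom c `&` cdom d)) (cfwd c \o cbwd d).

Definition is_smooth_atlas (A : set (chart M E)) : Prop :=
  [/\ (forall c, A c -> is_chart c),
      (forall x, exists2 c, A c & cdom c x) &
      (forall c d, A c -> A d -> compatible c d)].

(* charts of the maximal atlas containing [A] *)
Definition is_smooth_chart (A : set (chart M E)) (c : chart M E) : Prop :=
  is_chart c /\ forall d, A d -> compatible c d.

End Manifold.

Definition Ck_map (R : realType) (F E : tvsType R) (M N : topologicalType)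
    (k : option nat) (A : set (chart M F)) (B : set (chart N E))
    (W : set M) (f : M -> N) : Prop :=
  (forall x, W x -> {for x, continuous f}) /\
  (forall c d, A c -> B d ->
     Ck_on k (cfwd c @` (W `&` cdom c `&` f @^-1` cdom d))
             (cfwd d \o f \o cbwd c)).

(* The expression in the charts [c] (around [x]) and [d] (around [f x]) of the
   tangent map [d_x f]; tangent vectors are represented by their coordinates. *)
Definition tangent_map (R : realType) (F E : tvsType R) (M N : Type)
    (c : chart M F) (d : chart N E) (f : M -> N) (x : M) (v : F) : E :=
  dderive (cfwd d \o f \o cbwd c) (cfwd c x) v.

(** * Lie groups *)

(* No compatibility between the two structures is imposed here: continuity of
   the group operations is part of [is_lie_group]. *)
#[short(type="preTopologicalGroupType")]
HB.structure Definition PreTopologicalGroup := {G of Topological G & Group G}.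

Definition is_lie_group (R : realType) (E : tvsType R)
    (G : preTopologicalGroupType) (A : set (chart G E)) : Prop :=
  [/\ hausdorff_space G, is_smooth_atlas A,
      Ck_map None (prod_atlas A A) A setT (fun z : G * G => (z.1 * z.2)%g) &
      Ck_map None A A setT (fun g : G => (g^-1)%g)].

(* Throughout, [A] is the atlas of [G] and [Xi] the fixed chart around the unit.
   The Lie algebra [T_e G] is represented by the model space [E] through the
   topological isomorphism [d_e Xi], so that the seminorm [p \o d_e Xi] on
   [T_e G] is represented by [p] itself. *)
Section LieGroup.
Context {R : realType} {E : tvsType R} {G : preTopologicalGroupType}.
Variables (A : set (chart G E)) (Xi : chart G E).

Definition is_unit_chart : Prop :=
  [/\ is_smooth_chart A Xi, cdom Xi 1%g, cfwd Xi 1%g = 0 &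
      convex_set (cimg Xi)].

Definition Ad (g : G) (X : E) : E :=
  tangent_map Xi Xi (fun h => (g * h * g^-1)%g) 1%g X.

(* the left invariant vector field [g |-> d_e L_g X] in the chart [Xi] *)
Definition left_field (X : E) (x : E) : E :=
  tangent_map Xi Xi (fun h => (cbwd Xi x * h)%g) 1%g X.

(* the commutator of left invariant vector fields, at the unit *)
Definition bracket (X Y : E) : E :=
  let e := cfwd Xi 1%g in
  dderive (left_field Y) e (left_field X e) -
  dderive (left_field X) e (left_field Y e).

Definition submultiplicative : Prop :=
  forall v : cont_seminorm E, exists w : cont_seminorm E,
    seminorm_le v w /\ forall X Y, w (bracket X Y) <= w X * w Y.

Definition reliable : Prop :=
  forall v : cont_seminorm E,
    exists (V : set G) (w : nat -> cont_seminorm E),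
      [/\ nbhs (1%g : G) V, (forall g, V g -> V (g^-1)%g) &
          forall (n : nat) (g : 'I_n -> G), (1 <= n)%N -> (forall i, V (g i)) ->
            forall X, v (foldr Ad X [seq g i | i <- enum 'I_n]) <= w n X].

(** ** Curves on compact intervals *)

Definition Ck_ext_G (k : option nat) (a b : R) (mu : R -> G) : Prop :=
  exists I : set R, [/\ open I, is_interval I, `[a, b] `<=` I &
    Ck_map k (@line_atlas R) A I (mu : R^o -> G)].

Definition Ck_curve (k : option nat) (a b : R) (phi : R -> E) : Prop :=
  exists (I : set R) (psi : R^o -> E),
    [/\ open I, is_interval I, `[a, b] `<=` I, Ck_on k (I : set R^o) psi &
        forall t, t \in `[a, b] -> phi t = psi t].

Definition lip_curve (a b : R) (phi : R -> E) : Prop :=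
  forall p : cont_seminorm E, exists2 L : R, 0 <= L &
    forall t t', t \in `[a, b] -> t' \in `[a, b] ->
      p (phi t - phi t') <= L * `|t - t'|.

(* tangent vectors at [g] are represented in this chart; the right logarithmic
   derivative below does not depend on the choice *)
Definition chart_at (g : G) : chart G E := xget Xi [set c | A c /\ cdom c g].

Definition velocity (mu : R -> G) (t : R) : E :=
  dderive (cfwd (chart_at (mu t)) \o mu : R^o -> E) t 1.

Definition rlogder (mu : R -> G) (t : R) : E :=
  tangent_map (chart_at (mu t)) Xi (fun h => (h * (mu t)^-1)%g) (mu t)
    (velocity mu t).

(** ** Product integrals *)

(* [mu] is a primitive of [phi] on [[a, b]]. Curves on [[a, b]] are total
   functions, and [mu] is taken to be a [C^1] extension to a neighbourhood, so
   that its derivative makes sense at the end points. *)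
Definition primitive (a b : R) (phi : R -> E) (mu : R -> G) : Prop :=
  Ck_ext_G (Some 1%N) a b mu /\
  forall t, t \in `[a, b] -> phi t = rlogder mu t.

Definition integrable_on (a b : R) (phi : R -> E) : Prop :=
  exists mu, primitive a b phi mu.

Definition prod_int (a b : R) (phi : R -> E) (t : R) : G :=
  let mu := xget (fun=> 1%g) [set mu | primitive a b phi mu] in
  (mu t * (mu a)^-1)%g.

Record DP0_decomp (phi : R -> E) (n : nat) (t : nat -> R)
    (phis : nat -> R -> E) : Prop := {
  decomp_start : t 0%N = 0;
  decomp_end : t n = 1;
  decomp_lt : forall p, (p < n)%N -> t p < t p.+1;
  decomp_int : forall p, (p < n)%N -> integrable_on (t p) (t p.+1) (phis p);
  decomp_eq : forall p, (p < n)%N ->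
    forall s, s \in `]t p, t p.+1[ -> phi s = phis p s }.

Definition DP0 (phi : R -> E) : Prop :=
  exists n t phis, DP0_decomp phi n t phis.

Fixpoint prod_int_upto (t : nat -> R) (phis : nat -> R -> E) (p : nat) : G :=
  if p is q.+1 then
    (prod_int (t q) (t q.+1) (phis q) (t q.+1) * prod_int_upto t phis q)%g
  else 1%g.

Definition is_DP0_prod_int (phi : R -> E) (P : R -> G) : Prop :=
  exists n t phis, [/\ DP0_decomp phi n t phis, P 0 = 1%g &
    forall p, (p < n)%N -> forall s, s \in `]t p, t p.+1] ->
      P s = (prod_int (t p) (t p.+1) (phis p) s * prod_int_upto t phis p)%g].

Definition DP0_prod_int (phi : R -> E) : R -> G :=
  xget (fun=> 1%g) [set P | is_DP0_prod_int phi P].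

(** ** Integrability *)

Definition seminorm_sup (p : cont_seminorm E) (phi : R -> E) : \bar R :=
  ereal_sup [set (p (phi t))%:E | t in `[0, 1]].

Definition tame (phi : nat -> R -> E) : Prop :=
  forall v : cont_seminorm E, exists w : cont_seminorm E,
    seminorm_le v w /\
    forall (n : nat) (t : R), t \in `[0, 1] ->
      forall X, v (Ad ((DP0_prod_int (phi n) t)^-1)%g X) <= w X.

Definition unif_cauchy (phi : nat -> R -> E) : Prop :=
  forall (p : cont_seminorm E) (eps : R), 0 < eps ->
    exists N : nat, forall m n, (N <= m)%N -> (N <= n)%N ->
      (seminorm_sup p (fun t => phi m t - phi n t)%R <= eps%:E)%E.

Definition mackey_cauchy (phi : nat -> R -> E) : Prop :=
  exists (c : cont_seminorm E -> R) (l : cont_seminorm E -> nat)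
         (lambda : nat -> nat -> R),
    [/\ (forall p, 0 <= c p), (forall m n, 0 <= lambda m n),
        (fun mn : nat * nat => lambda mn.1 mn.2) @ filter_prod \oo \oo --> (0 : R) &
        forall p m n, (l p <= m)%N -> (l p <= n)%N ->
          (seminorm_sup p (fun t => phi m t - phi n t)%R
             <= (c p * lambda m n)%:E)%E].

Definition unif_converges (phi : nat -> R -> E) (psi : R -> E) : Prop :=
  forall p : cont_seminorm E,
    (fun n => seminorm_sup p (fun t => psi t - phi n t)) @ \oo --> (0%E : \bar R).

Definition s_integrable (psi : R -> E) : Prop :=
  exists phi : nat -> R -> E,
    [/\ (forall n, DP0 (phi n)), tame phi, unif_cauchy phi &
        unif_converges phi psi].

Definition m_integrable (psi : R -> E) : Prop :=
  exists phi : nat -> R -> E,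
    [/\ (forall n, DP0 (phi n)), tame phi, mackey_cauchy phi &
        unif_converges phi psi].

End LieGroup.

Inductive reg_index := RegFin of nat | RegLip | RegInf.

Definition reg_curve (R : realType) (E : tvsType R) (k : reg_index)
    (phi : R -> E) : Prop :=
  match k with
  | RegFin n => Ck_curve (Some n) 0 1 phi
  | RegLip => lip_curve 0 1 phi
  | RegInf => Ck_curve None 0 1 phi
  end.

Definition confined (R : realType) (E : tvsType R)
    (G : preTopologicalGroupType) (A : set (chart G E)) (Xi : chart G E)
    (k : reg_index) : Prop :=
  forall phi : R -> E, reg_curve k phi ->
    if k is RegFin 0 then s_integrable A Xi phi else m_integrable A Xi phi.

(* Main.v *)
Require Import Defs.
From HB Require Import structures.
From mathcomp Require Import all_boot all_order all_algebra.
From mathcomp Require Import all_classical all_reals all_analysis.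
From mathcomp Require Import ring lra.
Import Order.TTheory GRing.Theory Num.Theory.
Import numFieldNormedType.Exports.

(** The adjoint action turns curves in the group into solutions of a linear
    equation: if [mu] is a C^1-curve with right logarithmic derivative [phi],
    then the derivative of [Ad_(mu t) X] is the bracket of [phi t] and
    [Ad_(mu t) X] ([Ad_curve_deriv]). For a seminorm [w] with
    [w [X, Y] <= w X * w Y] and [w o phi <= C], Gronwall's inequality, run
    forwards and backwards in time, bounds [w o Ad] by [exp (C |t|) w]
    ([Ad_gronwall]). Everything else is a consequence.

    Tameness. Along a piecewise integrable curve the bounds of the pieces
    multiply, and the exponents add up to at most [C], whatever the number of
    pieces ([DP0_prod_int_bound]). Hence every uniformly bounded sequence of
    such curves is tame ([bounded_tame]).

    Confinedness. It remains to approximate a continuous curve [psi] on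
    [[0, 1]] by piecewise integrable ones. Constant curves need not be
    integrable, but on a short interval starting at [u] the curve
    [t |-> Xi^-1 ((t - u) psi u)] exists, and its logarithmic derivative is
    [omega ((t - u) psi u, psi u)] for a C^1-map [omega] with [omega (0, v) = v]
    ([rlog_chart]). With [1/n] as mesh this gives a sequence that converges to
    [psi] uniformly, because [[0, 1]] is compact
    ([continuous_s_integrable]), and at the rate [O(1/n)] for each seminorm if
    [psi] is Lipschitz ([lipschitz_m_integrable]). Curves of class C^k, k >= 1,
    are Lipschitz by the mean value inequality ([C1_curve_lip]).

    Bound near the unit. An element [g] close to the unit is the end point of
    [t |-> Xi^-1 (t Xi g)], whose logarithmic derivative is small, so [Ad_g] is
    bounded by [e] with respect to [w] ([Ad_locally_bounded]). Iteration gives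
    the bounds [e^n w] that make the group reliable.

    The equation for [Ad] is obtained in the chart [Xi]. Differentiating
    [(x y x^-1) x = x y] in [y], and then in [x] at the unit, expresses the
    derivative of [x |-> Ad_x Y] through the mixed second derivatives of the
    multiplication, and their symmetry identifies it with the bracket
    ([Ad_bracket]).

    The calculus rests on one device: [strict_deriv f x v l] asks the
    difference quotient of [f] to converge to [l] when the base point, the
    direction and the parameter move together. For this notion the chain rule
    is a composition of limits, and a map whose directional derivatives exist
    and are jointly continuous has strict derivatives by the mean value
    inequality ([C1_strict_deriv]). All estimates are made with seminorms, which
    determine the topology by [seminorm_ball]. *)

Set Implicit Arguments.
Unset Strict Implicit.
Unset Printing Implicit Defensive.
Local Open Scope classical_set_scope.
Local Open Scope ring_scope.

(** * Seminorms and the topology of a locally convex space *)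

Lemma convex_setP {R : realType} {E : lmodType R} (B : set E) (x y : E) (s t : R) :
  convex_set B -> 0 <= s -> 0 <= t -> s + t = 1 -> B x -> B y -> B (s *: x + t *: y).
Proof.
move=> cB s0 t0 st Bx By.
have s01 : Itv.spec (@Itv.num_sem R) (Itv.Real `[0%Z, 1%Z]) s.
  apply/andP; split; first exact: num_real.
  by rewrite /= in_itv /= s0 -st lerDl t0.
have := cB x y (Itv.mk s01) (mem_set Bx) (mem_set By).
by rewrite inE /= /conv /= (_ : t = 1 - s) // -st addrC addKr.
Qed.

Section Seminorms.
Context {R : realType} {E : tvsType R}.
Implicit Types (p : cont_seminorm E) (x y : E).

Lemma seminorm0 p : p 0 = 0.
Proof. by rewrite -(scale0r 0) seminormZ normr0 mul0r. Qed.

Lemma seminormN p x : p (- x) = p x.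
Proof. by rewrite -scaleN1r seminormZ normrN1 mul1r. Qed.

Lemma seminorm_ge0 p x : 0 <= p x.
Proof.
have := seminormD p x (- x); rewrite subrr seminorm0 seminormN => h.
by rewrite -(@pmulrn_lge0 _ _ 2)// mulr2n.
Qed.

Lemma seminorm_distC p x y : p (x - y) = p (y - x).
Proof. by rewrite -seminormN opprB. Qed.

Lemma seminorm_lerB p x y : p x <= p y + p (x - y).
Proof. by rewrite -{1}(subrK y x) addrC seminormD. Qed.

Lemma seminorm_dist3 p z x y : p (x - y) <= p (x - z) + p (z - y).
Proof. by rewrite -{1}(subrK z x) -addrA seminormD. Qed.

Lemma tvs_cvgD {T : Type} (F : set_system T) {FF : Filter F} (f g : T -> E)
    (a b : E) : f @ F --> a -> g @ F --> b -> (fun t => f t + g t) @ F --> a + b.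
Proof.
move=> fa gb.
exact: (continuous2_cvg _ (h := fun y z : E => y + z) (@add_continuous E (a, b))).
Qed.

Lemma tvs_cvgB {T : Type} (F : set_system T) {FF : Filter F} (f g : T -> E)
    (a b : E) : f @ F --> a -> g @ F --> b -> (fun t => f t - g t) @ F --> a - b.
Proof.
move=> fa gb.
exact: (continuous2_cvg _ (h := fun y z : E => y - z) (@sub_continuous E (a, b))).
Qed.

Lemma tvs_cvgZ {T : Type} (F : set_system T) {FF : Filter F} (s : T -> R)
    (f : T -> E) (k : R) (a : E) :
  s @ F --> k -> f @ F --> a -> (fun t => s t *: f t) @ F --> k *: a.
Proof.
move=> sk fa.
exact: (continuous2_cvg _ (h := fun (y : R^o) (z : E) => y *: z)
  (@scale_continuous R E (k, a))).
Qed.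

Lemma addr_cvg0 x : (fun y => y - x) @ x --> (0 : E).
Proof.
by rewrite -[X in _ --> X](subrr x); apply: tvs_cvgB; [exact: cvg_id | exact: cvg_cst].
Qed.

Lemma nbhs_seminorm_lt p x (e : R) : 0 < e -> \forall y \near x, p (y - x) < e.
Proof.
move=> e0; have : p \o (fun y => y - x) @ x --> p 0.
  apply: continuous_cvg; [exact: seminorm_continuous | exact: addr_cvg0].
rewrite seminorm0 => /cvgrPdist_lt/(_ _ e0); apply: filterS => y /=.
by rewrite sub0r normrN ger0_norm ?seminorm_ge0.
Qed.

(** A convex neighbourhood intersected with its opposite stays convex; symmetry
    is what makes the gauge below absolutely homogeneous. *)
Lemma locally_convex_sym (U : set E) : nbhs 0 U ->
  exists V : set E, [/\ V `<=` U, nbhs 0 V, (forall x, V x -> V (- x)) &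
    forall x y (s t : R), 0 <= s -> 0 <= t -> s + t = 1 -> V x -> V y ->
      V (s *: x + t *: y)].
Proof.
move=> U0; have [B convB [openB basisB]] := @locally_convex R E.
have [b [Bb b0] bU] := basisB 0 U U0.
have cb (x y : E) (s t : R) : 0 <= s -> 0 <= t -> s + t = 1 -> b x -> b y ->
    b (s *: x + t *: y) by apply: convex_setP; exact: convB b (mem_set Bb).
exists (b `&` [set x | b (- x)]); split.
- by move=> x [bx _]; exact: bU.
- apply: filterI; first by apply: open_nbhs_nbhs; split => //; exact: openB.
  have /= := @opp_continuous E 0; rewrite /continuous_at oppr0 => h.
  by apply: h; apply: open_nbhs_nbhs; split => //; exact: openB.
- by move=> x [bx bNx]; split => //=; rewrite opprK.
- move=> x y s t s0 t0 st [bx bNx] [by_ bNy]; split => /=; first exact: cb.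
  by rewrite opprD -!scalerN; exact: cb.
Qed.

(** The seminorm is the Minkowski gauge of a convex symmetric neighbourhood
    contained in [U]. Through this lemma estimates with continuous seminorms
    yield convergence in the topology. *)
Lemma seminorm_ball (U : set E) : nbhs 0 U ->
  exists p : cont_seminorm E, forall x, p x < 1 -> U x.
Proof.
move=> /locally_convex_sym[V [VU V0 Vsym Vconv]].
have V00 : V 0 by exact: nbhs_singleton.
pose S x : set R := [set t | 0 < t /\ V (t^-1 *: x)].
have Vscale x (s : R) : V x -> 0 <= s <= 1 -> V (s *: x).
  move=> Vx /andP[s0 s1]; rewrite -[s *: x]addr0 -(scaler0 _ (1 - s)).
  by apply: Vconv => //; [rewrite subr_ge0 | rewrite addrC subrK].
have Slb x : lbound (S x) 0 by move=> t [/ltW].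
have Shi x : has_inf (S x).
  split; last by exists 0.
  have := scale_continuous (0 : R^o, x).
  rewrite /continuous_at /= scale0r => /(_ _ V0)[[A1 A2] /= [A10 A2x] A12].
  have /nbhs_ballP[e /= e0 eA] := A10.
  exists (e / 2)^-1; split; first by rewrite invr_gt0 divr_gt0.
  rewrite invrK; apply: (A12 (_, _)); split => /=; last exact: nbhs_singleton.
  apply: eA; rewrite /ball /= sub0r normrN gtr0_norm ?divr_gt0//.
  by rewrite ltr_pdivrMr// ltr_pMr// ltr1n.
pose p x := inf (S x).
have p_ge0 x : 0 <= p x by apply: lb_le_inf; [exact: (Shi x).1 | exact: Slb].
have p_le x (t : R) : 0 < t -> V (t^-1 *: x) -> p x <= t.
  by move=> t0 Vt; apply: ge_inf; [exact: (Shi x).2 | split].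
have p_gt x (t : R) : p x < t -> V (t^-1 *: x) /\ 0 < t.
  move=> pt; have [s [s0 Vs] st] := inf_lt (Shi x).1 pt.
  have t0 : 0 < t by rewrite (lt_trans s0).
  split => //; have -> : t^-1 *: x = (s / t) *: (s^-1 *: x).
    by rewrite scalerA mulrAC mulfV ?mul1r// gt_eqF.
  apply: Vscale => //; rewrite divr_ge0 ?(ltW s0) ?(ltW t0)//=.
  by rewrite ler_pdivrMr// mul1r ltW.
have pD x y : p (x + y) <= p x + p y.
  apply/ler_addgt0Pr => e e0.
  have e20 : 0 < e / 2 by rewrite divr_gt0.
  have [Vx s0] := p_gt x (p x + e / 2) (ltac:(by rewrite ltrDl)).
  have [Vy t0] := p_gt y (p y + e / 2) (ltac:(by rewrite ltrDl)).
  set s := p x + e / 2 in Vx s0; set t := p y + e / 2 in Vy t0.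
  have st0 : 0 < s + t by rewrite addr_gt0.
  have -> : p x + p y + e = s + t by rewrite /s /t; field.
  apply: p_le => //.
  have -> : (s + t)^-1 *: (x + y) =
      (s / (s + t)) *: (s^-1 *: x) + (t / (s + t)) *: (t^-1 *: y).
    rewrite !scalerA scalerDr; congr (_ *: _ + _ *: _); field;
      by rewrite !gt_eqF.
  apply: Vconv => //; rewrite ?divr_ge0 ?ltW//.
  by rewrite -mulrDl divff// gt_eqF.
have p0 : p 0 = 0.
  apply/eqP; rewrite eq_le p_ge0 andbT; apply/ler_addgt0Pr => e e0.
  by rewrite add0r; apply: p_le => //; rewrite scaler0.
have pZle (a : R) x : p (a *: x) <= `|a| * p x.
  have [->|a0] := eqVneq a 0; first by rewrite scale0r p0 normr0 mul0r.
  have na0 : 0 < `|a| by rewrite normr_gt0.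
  rewrite -ler_pdivrMl//; apply/ler_addgt0Pr => e e0.
  have [Vx t0] := p_gt x (p x + e) (ltac:(by rewrite ltrDl)).
  rewrite ler_pdivrMl//; apply: p_le; first by rewrite mulr_gt0.
  have -> : (`|a| * (p x + e))^-1 *: (a *: x) =
      (a / `|a|) *: ((p x + e)^-1 *: x).
    by rewrite !scalerA; congr (_ *: _); field; rewrite !gt_eqF.
  have [a_ge0|a_lt0] := leP 0 a; first by rewrite ger0_norm// divff// scale1r.
  by rewrite ltr0_norm// invrN mulrN divff// scaleN1r; exact: Vsym.
have pZ (a : R) x : p (a *: x) = `|a| * p x.
  apply/eqP; rewrite eq_le pZle /=.
  have [->|a0] := eqVneq a 0; first by rewrite normr0 mul0r p_ge0.
  have na0 : 0 < `|a| by rewrite normr_gt0.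
  rewrite -ler_pdivlMl// -normfV.
  by rewrite -{1}(scale1r x) -(mulVf a0) -scalerA pZle.
have pC : continuous p.
  move=> x; apply/cvgrPdist_le => e e0.
  have pN y : p (- y) = p y by rewrite -scaleN1r pZ normrN1 mul1r.
  have eV : nbhs (0 : E) [set y | V (e^-1 *: y)].
    have : (fun y => e^-1 *: y) @ (0 : E) --> (e^-1 *: 0 : E).
      by apply: tvs_cvgZ; [exact: cvg_cst | exact: cvg_id].
    by rewrite scaler0; apply.
  have := addr_cvg0 x eV; rewrite /nbhs/=; apply: filterS => y /= Vy.
  have pxy := p_le _ _ e0 Vy.
  have h1 := pD (x - y) y; have h2 := pD (y - x) x.
  rewrite -(pN (x - y)) opprB subrK in h1; rewrite subrK in h2.
  by rewrite ler_norml; apply/andP; split; lra.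
exists (ContSeminorm pD pZ pC) => x /= px.
by apply: VU; have [] := p_gt x 1 px; rewrite invr1 scale1r.
Qed.

Lemma seminorm_nbhs (x : E) (U : set E) : nbhs x U ->
  exists p : cont_seminorm E, forall y, p (y - x) < 1 -> U y.
Proof.
move=> Ux; have : nbhs (0 : E) [set y | U (y + x)].
  have : (fun y => y + x) @ (0 : E) --> (0 + x : E).
    by apply: tvs_cvgD; [exact: cvg_id | exact: cvg_cst].
  by rewrite add0r => h; exact: h.
move=> /seminorm_ball[p pU]; exists p => y /pU /=; by rewrite subrK.
Qed.

Lemma cvg_seminorm_lt {T : Type} (F : set_system T) {FF : Filter F}
    (f : T -> E) (l : E) p (e : R) :
  f @ F --> l -> 0 < e -> \forall t \near F, p (f t - l) < e.
Proof. by move=> fl e0; exact: (fl _ (nbhs_seminorm_lt p l e0)). Qed.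

Lemma seminorm_cvg {T : Type} (F : set_system T) {FF : Filter F}
    (f : T -> E) (l : E) :
  (forall p (e : R), 0 < e -> \forall t \near F, p (f t - l) < e) -> f @ F --> l.
Proof.
move=> h U /seminorm_nbhs[p pU]; apply: filterS (h p 1 ltr01) => t.
exact: pU.
Qed.

Lemma seminorm_eq0 (x : E) : hausdorff_space E -> (forall p, p x = 0) -> x = 0.
Proof.
move=> hE px; apply/esym/hE => A B A0 /seminorm_nbhs[p pB]; exists 0; split.
  exact: nbhs_singleton.
by apply: pB; rewrite sub0r seminormN px.
Qed.

Lemma scaled_seminorm (c : R) p : 0 <= c ->
  exists q : cont_seminorm E, forall x, q x = c * p x.
Proof.
move=> c0.
have qD x y : c * p (x + y) <= c * p x + c * p y.
  by rewrite -mulrDr ler_wpM2l// seminormD.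
have qZ (a : R) x : c * p (a *: x) = `|a| * (c * p x).
  by rewrite seminormZ mulrCA.
have qC : continuous (fun x => c * p x).
  move=> x; apply: cvgM; first exact: cvg_cst.
  exact: seminorm_continuous.
by exists (ContSeminorm qD qZ qC).
Qed.

End Seminorms.

(** * A growth lemma on the real line *)

Section Growth.
Context {R : realType}.

(** A Gronwall inequality for functions that are not assumed differentiable:
    only the one-sided growth rate of [h] is controlled, so that it applies to
    the composition of a seminorm with a differentiable curve. The case [K = 0]
    gives mean value inequalities. *)
Lemma growth_bound (h : R -> R) (a b K : R) :
  a <= b -> 0 <= K -> 0 <= h a ->
  (forall t, a <= t <= b -> {for t, continuous h}) ->
  (forall t (e : R), a < t < b -> 0 < e ->
     \forall s \near t^'+, h s <= h t + (K * h t + e) * (s - t)) ->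
  h b <= expR (K * (b - a)) * h a.
Proof.
move=> ab K0 ha0 hC step.
have main (e : R) : 0 < e ->
    h b <= expR (K * (b - a)) * (h a + e + e * (b - a)).
  (* The comparison function satisfies [B' >= K B + e], which leaves room for
     the error [e] allowed in the growth rate; [e] tends to 0 at the end. *)
  move=> e0; pose B u := expR (K * (u - a)) * (h a + e + e * (u - a)).
  have BC : continuous B.
    move=> u; apply: (@continuousM _ _ (fun u => expR (K * (u - a)))
      (fun u => h a + e + e * (u - a))).
      apply: continuous_comp; last exact: continuous_expR.
      by apply: cvgM; [exact: cvg_cst | apply: cvgB; [exact: cvg_id | exact: cvg_cst]].
    apply: cvgD; first exact: cvg_cst.
    by apply: cvgM; [exact: cvg_cst | apply: cvgB; [exact: cvg_id | exact: cvg_cst]].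
  have Bstep t s : a <= t -> t <= s -> h t <= B t ->
      h t + (K * h t + e) * (s - t) <= B s.
    move=> at_ ts htB.
    pose Et := expR (K * (t - a)); pose ct := h a + e + e * (t - a).
    have Et1 : 1 <= Et by rewrite -expR0 ler_expR mulr_ge0// subr_ge0.
    have ct0 : 0 <= ct by rewrite /ct !addr_ge0// ?mulr_ge0// ?subr_ge0// ltW.
    have -> : B s = Et * expR (K * (s - t)) * (ct + e * (s - t)).
      rewrite /B /Et /ct -expRD; congr (expR _ * _); ring.
    have d0 : 0 <= s - t by rewrite subr_ge0.
    set d := s - t in d0 *.
    have hB : B t = Et * ct by [].
    have Kd0 : 0 <= K * d by rewrite mulr_ge0.
    have hexp : 1 + K * d <= expR (K * d) by exact: expR_ge1Dx.
    have h1 : h t + (K * h t + e) * d <= Et * ct + (K * (Et * ct) + e) * d.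
      rewrite -hB lerD// ler_wpM2r// lerD// ler_wpM2l//.
    apply: (le_trans h1).
    have h2 : Et * ct + (K * (Et * ct) + e) * d <= Et * (1 + K * d) * (ct + e * d).
      have : 0 <= (Et - 1) * (e * d) by rewrite !mulr_ge0// ?subr_ge0// ltW.
      have : 0 <= Et * (K * d) * (e * d).
        by rewrite !mulr_ge0// ?ltW// (lt_le_trans ltr01).
      by rewrite (_ : Et * (1 + K * d) * (ct + e * d) = Et * ct + (K * (Et * ct) + e) * d
        + (Et - 1) * (e * d) + Et * (K * d) * (e * d)); [lra | ring].
    apply: (le_trans h2); apply: ler_wpM2r.
      by rewrite addr_ge0// mulr_ge0// ltW.
    by apply: ler_wpM2l => //; rewrite (le_trans ler01).
  rewrite leNgt; apply/negP => hb.
  (* The first time at which [h] exceeds [B] cannot exist. *)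
  pose T := [set u | a <= u <= b /\ B u < h u].
  have Tb : T b by split => //; rewrite ab lexx.
  have Tinf : has_inf T.
    by split; [exists b | exists a => u [/andP[]]].
  pose c := inf T.
  have ac : a <= c by apply: lb_le_inf; [exists b | move=> u [/andP[]]].
  have cb : c <= b by apply: ge_inf => //; exact: Tinf.2.
  have below u : a <= u -> u < c -> h u <= B u.
    move=> au uc; rewrite leNgt; apply/negP => hu.
    suff : c <= u by rewrite leNgt uc.
    apply: ge_inf; first exact: Tinf.2.
    by split => //; rewrite au (le_trans (ltW uc)).
  have acb : a <= c <= b by rewrite ac cb.
  have near_gt t : a <= t <= b -> B t < h t -> \forall u \near t, B u < h u.
    move=> tab hBt; have : (fun u => h u - B u) @ t --> h t - B t.
      by apply: cvgB; [exact: hC | exact: BC].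
    have hB0 : 0 < h t - B t by rewrite subr_gt0.
    by move=> /cvgr_gt/(_ _ hB0); apply: filterS => u /=; rewrite subr_gt0.
  have near_lt t : a <= t <= b -> h t < B t -> \forall u \near t, h u < B u.
    move=> tab hBt; have : (fun u => B u - h u) @ t --> B t - h t.
      by apply: cvgB; [exact: BC | exact: hC].
    have hB0 : 0 < B t - h t by rewrite subr_gt0.
    by move=> /cvgr_gt/(_ _ hB0); apply: filterS => u /=; rewrite subr_gt0.
  have Ba : h a < B a.
    by rewrite /B subrr !mulr0 expR0 mul1r addr0 ltrDl.
  have Pc : h c <= B c.
    rewrite leNgt; apply/negP => hc.
    have [ca|ca] := eqVneq c a; first by move: hc; rewrite ca ltNge ltW.
    have ac' : a < c by rewrite lt_neqAle eq_sym ca.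
    have h1 : \forall u \near c^'-, B u < h u.
      exact: (filterS (fun u hu _ => hu) (near_gt c acb hc)).
    have h2 : \forall u \near c^'-, a < u by exact: nbhs_left_gt.
    have h3 : \forall u \near c^'-, u < c by exact: nbhs_left_lt.
    have [u [[h4 h5] h6]] := filter_ex (filterI (filterI h1 h2) h3).
    by move: h4; rewrite /= ltNge below// ltW.
  have cltb : c < b.
    rewrite lt_neqAle cb andbT; apply/eqP => cb'.
    by move: Pc; rewrite cb' leNgt hb.
  have right : \forall s \near c^'+, h s <= B s.
    have [ca|ca] := eqVneq c a.
      have h1 := near_lt c acb (ltac:(by rewrite ca)).
      have : \forall u \near c^'+, h u < B u by exact: (filterS (fun u hu _ => hu) h1).
      by apply: filterS => u /ltW.
    have ac' : a < c by rewrite lt_neqAle eq_sym ca.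
    have h1 := step c e (ltac:(by rewrite ac' cltb)) e0.
    have h2 : \forall u \near c^'+, c < u by exact: nbhs_right_gt.
    apply: filterS2 h1 h2 => s hs cs.
    exact: (le_trans hs (Bstep c s ac (ltW cs) Pc)).
  have [d /= d0 hd] := right.
  suff : c + d <= c by rewrite leNgt ltrDl d0.
  apply: lb_le_inf; first by exists b.
  move=> u [/andP[au ub] hu]; rewrite leNgt; apply/negP => ucd.
  have [uc|uc] := ltP u c; first by move: hu; rewrite ltNge below.
  have [ucE|ucN] := eqVneq u c; first by move: hu; rewrite ucE ltNge Pc.
  have cu : c < u by rewrite lt_neqAle eq_sym ucN.
  move: hu; rewrite ltNge hd//= distrC ger0_norm ?subr_ge0//.
  by rewrite ltrBlDl.
set X := expR _ in main *.
have X0 : 0 < X by exact: expR_gt0.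
apply/ler_addgt0Pr => e e0.
have k0 : 0 < X * (1 + (b - a)) by rewrite mulr_gt0// ltr_pwDl// subr_ge0.
have := main (e / (X * (1 + (b - a)))) (divr_gt0 e0 k0).
set e' := e / _ => h1; apply: (le_trans h1).
rewrite (_ : X * _ = X * h a + e' * (X * (1 + (b - a)))); last by ring.
by rewrite /e' divfK// gt_eqF.
Qed.

End Growth.

(** * Directional derivatives and curves *)

Lemma cvg_near_eq {T : Type} {U : nbhsType} (D : set_system T) {FD : Filter D}
    (f g : T -> U) (l : U) :
  (\forall t \near D, f t = g t) -> f @ D --> l -> g @ D --> l.
Proof. by move=> fg; apply: cvg_trans; exact: near_eq_cvg fg. Qed.

Lemma cvg_dnbhs0_eq {R : realType} {U : nbhsType} (f g : R -> U) (l : U) :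
  (forall t, t != 0 -> f t = g t) -> f @ (0 : R)^' --> l -> g @ (0 : R)^' --> l.
Proof. by move=> h; apply: cvg_near_eq; exists 1 => //= t _; exact: h. Qed.

Section DirectionalDerivative.
Context {R : realType} {F E : tvsType R}.
Implicit Types (f g : F -> E) (x v : F) (l m : E) (p : cont_seminorm E).

Lemma is_dderive_unique f x v l m : hausdorff_space E ->
  is_dderive f x v l -> is_dderive f x v m -> l = m.
Proof. by move=> hE fl fm; exact: (cvg_unique hE fl fm). Qed.

Lemma dderive_eq f x v l : hausdorff_space E ->
  is_dderive f x v l -> dderive f x v = l.
Proof.
move=> hE fl; have := @xgetPex _ 0 [set l | is_dderive f x v l] (ex_intro _ l fl).
by move=> h; exact: (is_dderive_unique hE h fl).
Qed.

Lemma dderiveP f x v : dderivable f x v -> is_dderive f x v (dderive f x v).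
Proof. exact: (@xgetPex _ 0 [set l | is_dderive f x v l]). Qed.

Lemma is_dderiveZ f x v l (a : R) :
  is_dderive f x v l -> is_dderive f x (a *: v) (a *: l).
Proof.
move=> fl; have [->|a0] := eqVneq a 0.
  rewrite !scale0r; apply: (cvg_dnbhs0_eq (f := fun=> 0)); last exact: cvg_cst.
  by move=> t _; rewrite /diff_quot scaler0 addr0 subrr scaler0.
have ta : (fun t : R => t * a) @ (0 : R)^' --> (0 : R)^'.
  move=> U [d /= d0 hU]; exists (d / `|a|); first by rewrite /= divr_gt0 ?normr_gt0.
  move=> t /=; rewrite sub0r normrN => td t0; apply: hU => /=.
    by rewrite sub0r normrN normrM -ltr_pdivlMr ?normr_gt0.
  by rewrite mulf_neq0.
have h := cvg_comp _ _ ta fl.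
apply: (cvg_dnbhs0_eq _ (tvs_cvgZ (cvg_cst a) h)) => t t0 /=.
by rewrite /diff_quot !scalerA invfM mulrCA mulfV// mulr1.
Qed.

Lemma is_dderiveB f g x v l m : is_dderive f x v l -> is_dderive g x v m ->
  is_dderive (fun y => f y - g y) x v (l - m).
Proof.
move=> fl gm; apply: (cvg_dnbhs0_eq _ (tvs_cvgB fl gm)) => t _.
by rewrite /diff_quot -scalerBr; congr (_ *: _); rewrite !opprD !opprK addrACA.
Qed.

End DirectionalDerivative.

Section Curves.
Context {R : realType} {E : tvsType R}.
Implicit Types (eta : R^o -> E) (p : cont_seminorm E).

Lemma curve_step p eta (t e : R) (l : E) : 0 < e ->
  is_dderive eta t 1 l ->
  \forall s \near t^'+, p (eta s - eta t) <= (p l + e) * (s - t).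
Proof.
move=> e0 /(cvg_seminorm_lt p)/(_ e0) [d /= d0 hd].
exists d => //= s /=; rewrite distrC => std ts.
have st0 : 0 < s - t by rewrite subr_gt0.
have := hd (s - t); rewrite /= sub0r normrN => /(_ std).
rewrite (gt_eqF st0) => /(_ isT); rewrite /diff_quot.
have -> : t + (s - t) *: (1 : R^o) = s.
  by rewrite /GRing.scale /= mulr1 addrC subrK.
move=> h; have : p ((s - t)^-1 *: (eta s - eta t)) <= p l + e.
  apply: (le_trans (seminorm_lerB p _ l)); by rewrite lerD2l ltW.
by rewrite seminormZ gtr0_norm ?invr_gt0// ler_pdivrMl// mulrC.
Qed.

Lemma seminorm_gronwall p eta (a b K : R) : a <= b -> 0 <= K ->
  (forall t, a <= t <= b -> {for t, continuous eta}) ->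
  (forall t, a < t < b -> exists2 l, is_dderive eta t 1 l & p l <= K * p (eta t)) ->
  p (eta b) <= expR (K * (b - a)) * p (eta a).
Proof.
move=> ab K0 etaC etaD.
apply: (@growth_bound _ (p \o eta)) => //=; first exact: seminorm_ge0.
- move=> t tab; apply: continuous_comp; first exact: etaC.
  exact: seminorm_continuous.
- move=> t e tab e0; have [l hl lK] := etaD t tab.
  have h2 : \forall u \near t^'+, t < u by exact: nbhs_right_gt.
  apply: filterS2 (curve_step p e0 hl) h2 => s h ts.
  apply: (le_trans (seminorm_lerB p _ (eta t))); rewrite lerD2l.
  by apply: (le_trans h); rewrite ler_pM2r ?subr_gt0// lerD2r.
Qed.

Lemma is_dderive_rev eta (c t : R) (l : E) : is_dderive eta (c - t) 1 l ->
  is_dderive (fun s : R^o => eta (c - s)) t 1 (- l).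
Proof.
move=> h.
have tN : (fun t : R => - t) @ (0 : R)^' --> (0 : R)^'.
  move=> U [d /= d0 hU]; exists d => //= s; rewrite /= sub0r normrN => sd s0.
  by apply: hU; rewrite /= ?sub0r ?opprK ?normrN// oppr_eq0.
have h1 := cvg_comp _ _ tN h.
have h2 : (fun s : R => -1 *: (diff_quot eta (c - t) 1 \o -%R) s) @ (0 : R)^' -->
    (- l) by rewrite -(scaleN1r l); apply: (tvs_cvgZ (cvg_cst _) h1).
apply: (cvg_dnbhs0_eq _ h2) => s s0 /=; rewrite /diff_quot scalerA invrN mulrNN mul1r.
by rewrite scaleNr opprD addrA.
Qed.

(** The inequality for the reversed curve. It is what controls the adjoint action
    of inverses by the logarithmic derivative of the curve itself. *)
Lemma seminorm_gronwall_rev p eta (a b K : R) : a <= b -> 0 <= K ->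
  (forall t, a <= t <= b -> {for t, continuous eta}) ->
  (forall t, a < t < b -> exists2 l, is_dderive eta t 1 l & p l <= K * p (eta t)) ->
  p (eta a) <= expR (K * (b - a)) * p (eta b).
Proof.
move=> ab K0 etaC etaD.
have revab (t : R) : a <= t <= b -> a <= a + b - t <= b.
  by move=> /andP[at_ tb]; apply/andP; split; lra.
have := @seminorm_gronwall p (fun s : R^o => eta (a + b - s)) a b K ab K0.
rewrite addrK [a + b]addrC addrK; apply.
- move=> t tab; apply: (@continuous_comp _ _ _ (fun s : R^o => b + a - s) eta).
    apply: (@tvs_cvgB R R^o); [exact: cvg_cst | exact: cvg_id].
  by apply: etaC; have := revab t tab; rewrite [a + b]addrC.
- move=> t /andP[at_ tb].
  have [|l hl lK] := etaD (b + a - t); first by apply/andP; split; lra.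
  by exists (- l); [exact: is_dderive_rev | rewrite seminormN].
Qed.

(** The growth lemma at rate 0, for [t |-> p (eta t - eta a) - C (t - a)]. *)
Lemma mean_value_curve p eta (a b C : R) : a <= b ->
  (forall t, a <= t <= b -> {for t, continuous eta}) ->
  (forall t, a < t < b -> exists2 l, is_dderive eta t 1 l & p l <= C) ->
  p (eta b - eta a) <= C * (b - a).
Proof.
move=> ab etaC etaD; pose h (t : R) := p (eta t - eta a) - C * (t - a).
suff : h b <= expR (0 * (b - a)) * h a.
  by rewrite mul0r expR0 mul1r /h !subrr seminorm0 mulr0 subrr subr_le0.
apply: growth_bound => //.
- by rewrite /h !subrr seminorm0 mulr0 subrr.
- move=> t tab; apply: cvgB; last first.
    by apply: cvgM; [exact: cvg_cst | apply: cvgB; [exact: cvg_id | exact: cvg_cst]].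
  apply: (@continuous_cvg _ _ _ _ _ (fun t => eta t - eta a) p).
    exact: seminorm_continuous.
  by apply: tvs_cvgB; [exact: etaC | exact: cvg_cst].
- move=> t e tab e0; have [l hl lC] := etaD t tab.
  have h2 : \forall u \near t^'+, t < u by exact: nbhs_right_gt.
  apply: filterS2 (curve_step p e0 hl) h2 => s hs ts; rewrite /h mul0r add0r.
  have := seminorm_dist3 p (eta t) (eta s) (eta a).
  have : (p l + e) * (s - t) <= (C + e) * (s - t).
    by rewrite ler_pM2r ?subr_gt0// lerD2r.
  lra.
Qed.

End Curves.

(** * Strict directional derivatives *)

(** The base point [z.1.1], the direction [z.1.2] and the parameter [z.2] of the
    difference quotient vary simultaneously. *)
Definition strict_deriv {R : realType} {F E : tvsType R}
    (f : F -> E) (x v : F) (l : E) : Prop :=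
  diff_quot f z.1.1 z.1.2 z.2 @[z --> filter_prod (nbhs (x, v)) (0 : R)^'] --> l.

Section StrictDerivative.
Context {R : realType}.

Lemma near_prod_dnbhs0 {T : Type} (D : set_system T) {FD : Filter D} :
  \forall z \near filter_prod D (0 : R)^', z.2 != 0.
Proof.
have h : \forall t \near (0 : R)^', t != 0 by exact: nbhs_dnbhs_neq.
exact: (cvg_snd h).
Qed.

Lemma cvg_to_prod {T U V : Type} (F : set_system T) {FF : Filter F}
    (G : set_system U) (H : set_system V) {FG : Filter G} {FH : Filter H}
    (f : T -> U) (g : T -> V) :
  f @ F --> G -> g @ F --> H -> (fun t => (f t, g t)) @ F --> filter_prod G H.
Proof. by move=> fG gH; exact: (cvg_pair fG gH). Qed.

Section Basic.
Context {F E : tvsType R}.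
Implicit Types (f : F -> E) (x v : F) (l : E).

Lemma base_cvg x v :
  (fun z : F * F * R => z.1.1) @ filter_prod (nbhs (x, v)) (0 : R)^' --> x.
Proof. exact: (cvg_comp _ _ cvg_fst cvg_fst). Qed.

Lemma dir_cvg x v :
  (fun z : F * F * R => z.1.2) @ filter_prod (nbhs (x, v)) (0 : R)^' --> v.
Proof. exact: (cvg_comp _ _ cvg_fst cvg_snd). Qed.

Lemma time_cvg x v :
  (fun z : F * F * R => z.2) @ filter_prod (nbhs (x, v)) (0 : R)^' --> (0 : R).
Proof. by apply: cvg_trans; [exact: cvg_snd | exact: nbhs_dnbhs]. Qed.

Lemma line_cvg x v w : (fun z : F * F * R => z.1.1 + z.2 *: w) @
  filter_prod (nbhs (x, v)) (0 : R)^' --> x.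
Proof.
rewrite -[X in _ --> X]addr0 -(scale0r w); apply: tvs_cvgD; first exact: base_cvg.
by apply: tvs_cvgZ; [exact: (@time_cvg x v) | exact: cvg_cst].
Qed.

Lemma end_cvg x v : (fun z : F * F * R => z.1.1 + z.2 *: z.1.2) @
  filter_prod (nbhs (x, v)) (0 : R)^' --> x.
Proof.
rewrite -[X in _ --> X]addr0 -(scale0r v); apply: tvs_cvgD; first exact: base_cvg.
by apply: tvs_cvgZ; [exact: (@time_cvg x v) | exact: dir_cvg].
Qed.

Lemma strict_deriv_near f g x v l : (\forall y \near x, f y = g y) ->
  strict_deriv f x v l -> strict_deriv g x v l.
Proof.
move=> fg fl; apply: (cvg_near_eq _ fl).
have h1 : \forall z \near filter_prod (nbhs (x, v)) (0 : R)^', f z.1.1 = g z.1.1.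
  exact: (@base_cvg x v _ fg).
have h2 : \forall z \near filter_prod (nbhs (x, v)) (0 : R)^',
    f (z.1.1 + z.2 *: z.1.2) = g (z.1.1 + z.2 *: z.1.2).
  exact: (@end_cvg x v _ fg).
by apply: filterS2 h1 h2 => z /= h1 h2; rewrite /diff_quot h1 h2.
Qed.

Lemma strict_is_dderive f x v l : strict_deriv f x v l -> is_dderive f x v l.
Proof.
move=> fl; have h : (fun t : R => ((x, v), t)) @ (0 : R)^' -->
    filter_prod (nbhs (x, v)) (0 : R)^'.
  by apply: cvg_to_prod; [exact: cvg_cst | exact: cvg_id].
exact: (cvg_comp _ _ h fl).
Qed.

Lemma strict_deriv_unique f x v l m : hausdorff_space E ->
  strict_deriv f x v l -> strict_deriv f x v m -> l = m.
Proof.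
by move=> hE /strict_is_dderive h1 /strict_is_dderive; exact: is_dderive_unique.
Qed.

Lemma strict_dderive f x v l : hausdorff_space E ->
  strict_deriv f x v l -> dderive f x v = l.
Proof. by move=> hE /strict_is_dderive; exact: dderive_eq. Qed.

(** The direction 0 suffices: for a fixed small [t], a point [y] near [x] reaches
    [x] along the direction [(x - y) / t], which is close to 0. *)
Lemma strict_deriv_continuous f x l : strict_deriv f x 0 l ->
  {for x, continuous f}.
Proof.
move=> fl; apply: seminorm_cvg => p e e0.
have [[P Q] /= [Px Q0] PQ] := cvg_seminorm_lt p fl ltr01.
have pl0 : 0 < p l + 1 by rewrite ltr_pwDr// seminorm_ge0.
have : \forall t \near (0 : R)^', `|t| < e / (p l + 1).
  exists (e / (p l + 1)); first by rewrite /= divr_gt0.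
  by move=> t /=; rewrite sub0r normrN.
move=> /(filterI Q0)/(filterI (@nbhs_dnbhs_neq _ (0 : R))) h.
(* A fixed step size [t], small enough for [t (p l + 1) < e] *)
have [t [t0 [Qt te]]] := filter_ex h.
have c1 : (fun y : F => t^-1 *: (x - y)) @ x --> (0 : F).
  rewrite -[X in _ --> X](scaler0 _ t^-1).
  apply: tvs_cvgZ; first exact: cvg_cst.
  by rewrite -(subrr x); apply: tvs_cvgB; [exact: cvg_cst | exact: cvg_id].
have c2 : (fun y : F => (y, t^-1 *: (x - y))) @ x --> (x, 0 : F).
  by apply: cvg_to_prod; [exact: cvg_id | exact: c1].
have c3 : \forall y \near x, P (y, t^-1 *: (x - y)) by exact: (c2 _ Px).
apply: filterS c3 => y Py.
have /= := PQ ((y, t^-1 *: (x - y)), t) (conj Py Qt).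
set q := diff_quot _ _ _ _ => hq.
have -> : f y - f x = - (t *: q).
  by rewrite /q /diff_quot /= !scalerA !divff// !scale1r addrCA subrr addr0 opprB.
rewrite seminormN seminormZ.
have pq : p q <= p l + 1.
  by apply: (le_trans (seminorm_lerB p q l)); rewrite lerD2l ltW.
by apply: (le_lt_trans (ler_wpM2l (normr_ge0 t) pq)); rewrite -ltr_pdivlMr.
Qed.

(** The step from [y] to [y + t w'] with [w'] near [v + w] splits into the steps
    along [v] and along [w' - v]; the second one starts at a moving base point,
    which strictness allows. *)
Lemma strict_deriv_dirD f x v w l m : strict_deriv f x v l -> strict_deriv f x w m ->
  strict_deriv f x (v + w) (l + m).
Proof.
move=> fl fm; rewrite /strict_deriv.
have c1 := @base_cvg x (v + w); have c2 := @dir_cvg x (v + w).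
have c4 := @line_cvg x (v + w) v.
have c5 : (fun z : F * F * R => z.1.2 - v) @ filter_prod (nbhs (x, v + w)) (0 : R)^'
   --> w.
  rewrite -[X in _ --> X](addrK v) [w + v]addrC.
  by apply: tvs_cvgB; [exact: c2 | exact: cvg_cst].
have d1 : (fun z : F * F * R => ((z.1.1, v), z.2)) @ filter_prod (nbhs (x, v + w)) (0 : R)^'
   --> filter_prod (nbhs (x, v)) (0 : R)^'.
  apply: cvg_to_prod; last exact: cvg_snd.
  by apply: cvg_to_prod => //; exact: cvg_cst.
have d2 : (fun z : F * F * R => ((z.1.1 + z.2 *: v, z.1.2 - v), z.2))
   @ filter_prod (nbhs (x, v + w)) (0 : R)^'
   --> filter_prod (nbhs (x, w)) (0 : R)^'.
  apply: cvg_to_prod; last exact: cvg_snd.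
  by apply: cvg_to_prod.
apply: (cvg_near_eq _ (tvs_cvgD (cvg_comp _ _ d1 fl) (cvg_comp _ _ d2 fm))).
apply: nearW => z /=.
rewrite /diff_quot -scalerDr; congr (_ *: _).
have -> : z.1.1 + z.2 *: v + z.2 *: (z.1.2 - v) = z.1.1 + z.2 *: z.1.2.
  by rewrite -addrA -scalerDr [v + _]addrC subrK.
by rewrite addrC addrA subrK.
Qed.

End Basic.
End StrictDerivative.

Section StrictRules.
Context {R : realType}.

(** The difference quotient of [g o f] is the one of [g] at the base point [f y] in
    the direction of the difference quotient of [f], so the limits compose. *)
Lemma strict_deriv_comp {F E H : tvsType R} (f : F -> E) (g : E -> H) (x v : F)
    (l : E) (m : H) : {for x, continuous f} ->
  strict_deriv f x v l -> strict_deriv g (f x) l m -> strict_deriv (g \o f) x v m.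
Proof.
move=> fC fl gm.
have h : (fun z : F * F * R => ((f z.1.1, diff_quot f z.1.1 z.1.2 z.2), z.2)) @
    filter_prod (nbhs (x, v)) (0 : R)^' --> filter_prod (nbhs (f x, l)) (0 : R)^'.
  have h0 : (fun z : F * F * R => f z.1.1) @ filter_prod (nbhs (x, v)) (0 : R)^' --> f x.
    by apply: (continuous_cvg _ fC); exact: base_cvg.
  have h2 : (fun z : F * F * R => z.2) @ filter_prod (nbhs (x, v)) (0 : R)^' -->
      (0 : R)^' by exact: cvg_snd.
  exact: (cvg_to_prod (cvg_to_prod h0 fl) h2).
apply: (cvg_near_eq _ (cvg_comp _ _ h gm)).
apply: filterS (@near_prod_dnbhs0 R _ (nbhs (x, v)) _) => z z0 /=.
rewrite /diff_quot /=; congr (_ *: (g _ - _)).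
by rewrite scalerA divff// scale1r addrC subrK.
Qed.

Lemma strict_deriv_pair {F E H : tvsType R} (f : F -> E) (g : F -> H) (x v : F)
    (l : E) (m : H) : strict_deriv f x v l -> strict_deriv g x v m ->
  strict_deriv (fun y => (f y, g y) : (E * H)%type) x v (l, m).
Proof. by move=> fl gm; exact: (cvg_to_prod fl gm). Qed.

(** Covers projections, constants and the maps [t |-> t w] at once. *)
Lemma strict_deriv_affine {F E : tvsType R} (f g : F -> E) (x v : F) :
  (forall y w (t : R), f (y + t *: w) = f y + t *: g w) ->
  {for v, continuous g} -> strict_deriv f x v (g v).
Proof.
move=> fg gC.
have h : (fun z : F * F * R => g z.1.2) @ filter_prod (nbhs (x, v)) (0 : R)^' --> g v.
  by apply: (continuous_cvg _ gC); exact: dir_cvg.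
apply: (cvg_near_eq _ h).
apply: filterS (@near_prod_dnbhs0 R _ (nbhs (x, v)) _) => z z0 /=.
by rewrite /diff_quot fg [f _ + _]addrC addrK scalerA mulVf// scale1r.
Qed.

Lemma strict_deriv_cst {F E : tvsType R} (c : E) (x v : F) :
  strict_deriv (fun _ => c) x v 0.
Proof.
apply: (strict_deriv_affine (g := fun=> 0)); last exact: cvg_cst.
by move=> *; rewrite scaler0 addr0.
Qed.

Lemma strict_deriv_id {F : tvsType R} (x v : F) : strict_deriv id x v v.
Proof. by apply: (strict_deriv_affine (g := id)) => //; exact: cvg_id. Qed.

Lemma strict_deriv_fst {F E : tvsType R} (x v : F * E) : strict_deriv fst x v v.1.
Proof. by apply: (strict_deriv_affine (g := fst)) => //; exact: cvg_fst. Qed.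

Lemma strict_deriv_snd {F E : tvsType R} (x v : F * E) : strict_deriv snd x v v.2.
Proof. by apply: (strict_deriv_affine (g := snd)) => //; exact: cvg_snd. Qed.

Lemma strict_deriv_scale {E : tvsType R} (w : E) (s h : R^o) :
  strict_deriv (fun t : R^o => t *: w) s h (h *: w).
Proof.
apply: (strict_deriv_affine (g := fun t : R^o => t *: w)).
  by move=> a b t; rewrite scalerDl scalerA.
by apply: tvs_cvgZ; [exact: cvg_id | exact: cvg_cst].
Qed.

(** Each [df y w] is a limit of difference quotients which strictness at [(x, v)]
    keeps close to [df x v]. *)
Lemma strict_deriv_contD {F E : tvsType R} (f : F -> E) (df : F -> F -> E) (x v : F) :
  (\forall y \near x, forall w, strict_deriv f y w (df y w)) ->
  {for (x, v), continuous (fun z : F * F => df z.1 z.2)}.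
Proof.
move=> fdf; apply: seminorm_cvg => p e e0.
have e20 : 0 < e / 2 by rewrite divr_gt0.
have fl := nbhs_singleton fdf v.
have [[P Q] /= [Px Q0] PQ] := cvg_seminorm_lt p fl e20.
have h1 : \forall z \near (x, v), forall w, strict_deriv f z.1 w (df z.1 w).
  exact: (@cvg_fst _ _ (nbhs x) (nbhs v) _ _ fdf).
apply: filterS2 Px h1 => -[y w] /= Pyw h.
have hh := strict_is_dderive (h w).
have h3 : \forall t \near (0 : R)^', Q t /\ p (diff_quot f y w t - df y w) < e / 2.
  by apply: filterI => //; exact: (cvg_seminorm_lt p hh e20).
have [t [Qt ht]] := filter_ex h3.
have := PQ ((y, w), t) (conj Pyw Qt); rewrite /= in ht *.
have := seminorm_dist3 p (diff_quot f y w t) (df y w) (df x v).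
rewrite (seminorm_distC p (df y w) (diff_quot f y w t)); lra.
Qed.

Lemma is_dderive_continuous_curve {E : tvsType R} (eta : R^o -> E) (t : R) (l : E) :
  is_dderive eta t 1 l -> {for t, continuous eta}.
Proof.
move=> h; apply: seminorm_cvg => p e e0.
have [d /= d0 hd] := cvg_seminorm_lt p h ltr01.
have pl0 : 0 < p l + 1 by rewrite ltr_pwDr// seminorm_ge0.
exists (Num.min d (e / (p l + 1))); first by rewrite /= lt_min d0 divr_gt0.
move=> s /=; rewrite lt_min distrC => /andP[sd se].
have [->|st] := eqVneq s t; first by rewrite subrr seminorm0.
have st0 : s - t != 0 by rewrite subr_eq0.
have := hd (s - t); rewrite /= sub0r normrN => /(_ sd st0).
set q := diff_quot _ _ _ _ => hq.
have -> : eta s - eta t = (s - t) *: q.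
  rewrite /q /diff_quot scalerA divff// scale1r; congr (eta _ - _).
  by rewrite /GRing.scale /= mulr1 addrC subrK.
rewrite seminormZ; have pq : p q <= p l + 1.
  by apply: (le_trans (seminorm_lerB p q l)); rewrite lerD2l ltW.
by apply: (le_lt_trans (ler_wpM2l (normr_ge0 _) pq)); rewrite -ltr_pdivlMr.
Qed.

Lemma is_dderive_line {F E : tvsType R} (f : F -> E) (y w : F) (s : R) (l : E) :
  is_dderive f (y + s *: w) w l ->
  is_dderive (fun s : R^o => f (y + s *: w)) s 1 l.
Proof.
move=> h; apply: (cvg_dnbhs0_eq _ h) => t t0; rewrite /diff_quot.
congr (_ *: (f _ - _)); rewrite -addrA -scalerDl; congr (_ + _ *: _).
by rewrite /GRing.scale /= mulr1.
Qed.

(** The mean value inequality relative to an affine comparison map: subtracting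
    [m] shows that [f] grows like [m] wherever its derivative is close to [m]. *)
Lemma mean_value_line {F E : tvsType R} (p : cont_seminorm E) (f : F -> E)
    (y w : F) (m : E) (C : R) :
  (forall s : R, 0 <= s <= 1 ->
     exists2 l, is_dderive f (y + s *: w) w l & p (l - m) <= C) ->
  p (f (y + w) - f y - m) <= C.
Proof.
move=> h; pose eta (s : R^o) : E := f (y + s *: w) - s *: m.
have etaD s : 0 <= s <= 1 -> exists2 l, is_dderive eta s 1 l & p l <= C.
  move=> /h[l hl lC]; exists (l - m) => //.
  apply: is_dderiveB; first exact: is_dderive_line.
  rewrite -{2}(scale1r m); apply: strict_is_dderive; exact: strict_deriv_scale.
have -> : f (y + w) - f y - m = eta 1 - eta 0.
  by rewrite /eta !scale0r addr0 subr0 !scale1r addrAC.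
have := @mean_value_curve _ _ p eta 0 1 C ler01.
rewrite subr0 mulr1; apply.
- by move=> t /etaD[l hl _]; exact: is_dderive_continuous_curve hl.
- by move=> t /andP[/ltW t0 /ltW t1]; apply: etaD; rewrite t0 t1.
Qed.

(** By the mean value inequality a difference quotient differs from [df x v] by at
    most the oscillation of [df] along the segment, and that segment lies in a
    seminorm ball around [x] once the parameter is small. *)
Lemma C1_strict_deriv {F E : tvsType R} (f : F -> E) (df : F -> F -> E) (x v : F) :
  (\forall y \near x, forall w, is_dderive f y w (df y w)) ->
  {for (x, v), continuous (fun z : F * F => df z.1 z.2)} ->
  strict_deriv f x v (df x v).
Proof.
move=> fdf dfC; apply: seminorm_cvg => p e e0.
have e20 : 0 < e / 2 by rewrite divr_gt0.
have [[A B] /= [Ax Bv] AB] := cvg_seminorm_lt p dfC e20.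
have [q qA] := seminorm_nbhs (filterI Ax fdf).
have qv0 : 0 < q v + 1 by rewrite ltr_pwDr// seminorm_ge0.
have half0 : 0 < 2^-1 :> R by rewrite invr_gt0.
have N1 : \forall z \near filter_prod (nbhs (x, v)) (0 : R)^', q (z.1.1 - x) < 2^-1.
  exact: (@base_cvg _ _ x v _ (nbhs_seminorm_lt q x half0)).
have N2 : \forall z \near filter_prod (nbhs (x, v)) (0 : R)^', q (z.1.2 - v) < 1 /\ B z.1.2.
  exact: (@dir_cvg _ _ x v _ (filterI (nbhs_seminorm_lt q v ltr01) Bv)).
have N3 : \forall z \near filter_prod (nbhs (x, v)) (0 : R)^',
    `|z.2| < 2^-1 / (q v + 1).
  have : \forall t \near (0 : R), `|t| < 2^-1 / (q v + 1).
    exists (2^-1 / (q v + 1)); first by rewrite /= divr_gt0.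
    by move=> t /=; rewrite sub0r normrN.
  move=> h; exact: (@time_cvg _ _ x v _ h).
have N4 : \forall z \near filter_prod (nbhs (x, v)) (0 : R)^', z.2 != 0.
  exact: near_prod_dnbhs0.
have N12 : \forall z \near filter_prod (nbhs (x, v)) (0 : R)^',
    [/\ q (z.1.1 - x) < 2^-1, q (z.1.2 - v) < 1 & B z.1.2].
  by apply: filterS2 N1 N2 => z h1 [h2 h3].
apply: filterS3 N12 N3 N4 => -[[y w] t] /= [qy qw Bw] qt t0.
have qw1 : q w <= q v + 1 by apply: (le_trans (seminorm_lerB q w v)); rewrite lerD2l ltW.
have : p (f (y + t *: w) - f y - t *: df x v) <= `|t| * (e / 2).
  apply: mean_value_line => s /andP[s0 s1].
  have [|As dfs] := qA (y + s *: (t *: w)).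
    have h1 := seminorm_dist3 q y (y + s *: (t *: w)) x.
    have h2 : q (y + s *: (t *: w) - y) < 2^-1.
      rewrite addrC addKr !seminormZ ger0_norm// mulrA.
      have h3 : `|t| * q w < 2^-1.
        apply: (le_lt_trans (ler_wpM2l (normr_ge0 _) qw1)).
        by rewrite -ltr_pdivlMr.
      apply: (le_lt_trans _ h3); rewrite -mulrA ler_piMl//.
      by rewrite mulr_ge0// seminorm_ge0.
    by apply: (le_lt_trans h1); lra.
  exists (t *: df (y + s *: (t *: w)) w); first exact: is_dderiveZ.
  rewrite -scalerBr seminormZ ler_wpM2l//.
  by have := AB (y + s *: (t *: w), w) (conj As Bw) => /ltW.
have -> : f (y + t *: w) - f y - t *: df x v = t *: (diff_quot f y w t - df x v).
  by rewrite scalerBr /diff_quot scalerA divff// scale1r.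
rewrite seminormZ ler_pM2l ?normr_gt0// => h; apply: (le_lt_trans h).
lra.
Qed.

End StrictRules.

Arguments strict_deriv_cst {R F E} c x v.
Arguments strict_deriv_id {R F} x v.
Arguments strict_deriv_fst {R F E} x v.
Arguments strict_deriv_snd {R F E} x v.

(** * Twice continuously differentiable maps *)

(** Second order differentiability through the tangent map: [df] is regarded as
    a function of the pair of base point and direction and is again
    differentiable. In this form the chain rule of the first order iterates. *)
Definition C2_at {R : realType} {F E : tvsType R} (f : F -> E) (x : F) : Prop :=
  exists (df : F -> F -> E) (d2f : F -> F -> F * F -> E), \forall y \near x,
    (forall v, strict_deriv f y v (df y v)) /\
    (forall v w, strict_deriv (fun z : F * F => df z.1 z.2) (y, v) w (d2f y v w)).

Section C2.
Context {R : realType}.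

Lemma C2_at_continuous {F E : tvsType R} (f : F -> E) x :
  C2_at f x -> {for x, continuous f}.
Proof.
by move=> [df [d2f /nbhs_singleton[h _]]]; exact: strict_deriv_continuous (h 0).
Qed.

Lemma C2_at_near {F E : tvsType R} (f g : F -> E) x :
  (\forall y \near x, f y = g y) -> C2_at f x -> C2_at g x.
Proof.
move=> fg [df [d2f h]]; exists df, d2f.
apply: filterS2 (near_join fg) h => y fgy [h1 h2]; split => // v.
exact: (strict_deriv_near fgy).
Qed.

Lemma C2_at_comp {F E H : tvsType R} (f : F -> E) (g : E -> H) x :
  C2_at f x -> C2_at g (f x) -> C2_at (g \o f) x.
Proof.
move=> Cf [dg [d2g hg]]; have fC := C2_at_continuous Cf.
move: Cf => [df [d2f hf]].
exists (fun y v => dg (f y) (df y v)).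
exists (fun y v w => d2g (f y) (df y v) (df y w.1, d2f y v w)).
have hgf : \forall y \near x,
    (forall v, strict_deriv g (f y) v (dg (f y) v)) /\
    (forall v w, strict_deriv (fun z : E * E => dg z.1 z.2) (f y, v) w (d2g (f y) v w)).
  exact: (fC _ hg).
apply: filterS2 hf hgf => y [f1 f2] [g1 g2]; split.
  move=> v; apply: (strict_deriv_comp _ (f1 v) (g1 _)).
  exact: strict_deriv_continuous (f1 0).
move=> v w.
pose k (z : F * F) : (E * E)%type := (f z.1, df z.1 z.2).
have kw u : strict_deriv k (y, v) u (df y u.1, d2f y v u).
  apply: strict_deriv_pair; last exact: f2.
  have c1 : {for (y, v), continuous (@fst F F)} by exact: cvg_fst.
  exact: (strict_deriv_comp c1 (strict_deriv_fst (y, v) u) (f1 u.1)).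
have kC : {for (y, v), continuous k} by exact: strict_deriv_continuous (kw 0).
exact: (strict_deriv_comp kC (kw w) (g2 _ _)).
Qed.

Lemma C2_at_pair {F E H : tvsType R} (f : F -> E) (g : F -> H) x :
  C2_at f x -> C2_at g x -> C2_at (fun y => (f y, g y) : (E * H)%type) x.
Proof.
move=> [df [d2f hf]] [dg [d2g hg]].
exists (fun y v => (df y v, dg y v)), (fun y v w => (d2f y v w, d2g y v w)).
apply: filterS2 hf hg => y [f1 f2] [g1 g2].
split=> [v|v w]; first exact: (strict_deriv_pair (f1 v) (g1 v)).
exact: (strict_deriv_pair (f2 v w) (g2 v w)).
Qed.

Lemma C2_at_affine {F E : tvsType R} (f g : F -> E) x :
  (forall y w (t : R), f (y + t *: w) = f y + t *: g w) ->
  (forall y w (t : R), g (y + t *: w) = g y + t *: g w) ->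
  continuous g -> C2_at f x.
Proof.
move=> fg gg gC; exists (fun _ v => g v), (fun _ _ w => g w.2).
apply: nearW => y; split=> [v|v w]; first exact: (strict_deriv_affine _ fg (gC v)).
apply: (@strict_deriv_affine _ _ _ (fun z => g z.2) (fun z => g z.2)).
  by move=> a b t; rewrite -gg.
by apply: (@continuous_comp _ _ _ snd g); [exact: cvg_snd | exact: gC].
Qed.

Lemma C2_at_id {F : tvsType R} (x : F) : C2_at id x.
Proof. by apply: (C2_at_affine (g := id)) => // y; exact: cvg_id. Qed.

Lemma C2_at_cst {F E : tvsType R} (c : E) (x : F) : C2_at (fun=> c) x.
Proof.
apply: (C2_at_affine (g := fun=> 0)) => [||y]; last exact: cvg_cst.
- by move=> *; rewrite scaler0 addr0.
- by move=> *; rewrite scaler0 addr0.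
Qed.

Lemma C2_at_fst {F E : tvsType R} (x : F * E) : C2_at fst x.
Proof. by apply: (C2_at_affine (g := fst)) => // y; exact: cvg_fst. Qed.

Lemma C2_at_snd {F E : tvsType R} (x : F * E) : C2_at snd x.
Proof. by apply: (C2_at_affine (g := snd)) => // y; exact: cvg_snd. Qed.

Lemma C2_at_dderive {F E : tvsType R} (f : F -> E) x : hausdorff_space E ->
  C2_at f x -> \forall y \near x,
    (forall v, strict_deriv f y v (dderive f y v)) /\
    (forall v w, exists l,
       strict_deriv (fun z : F * F => dderive f z.1 z.2) (y, v) w l).
Proof.
move=> hE [df [d2f h]]; apply: filterS (near_join h) => y hy.
have [h1 h2] := nbhs_singleton hy; split.
  by move=> v; rewrite (strict_dderive hE (h1 v)); exact: h1.
move=> v w; exists (d2f y v w).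
apply: strict_deriv_near (h2 v w).
have h3 : \forall z \near (y, v), forall u, strict_deriv f z.1 u (df z.1 u).
  have hy1 : \forall a \near y, forall u, strict_deriv f a u (df a u).
    by apply: filterS hy => z [].
  exact: (@cvg_fst _ _ (nbhs y) (nbhs v) _ _ hy1).
by apply: filterS h3 => z h3; rewrite (strict_dderive hE (h3 _)).
Qed.

(** * Comparison with iterated directional derivatives *)

Lemma ptws_cvg {T I : Type} {F : topologicalType} (D : set_system T) {FD : Filter D}
    (f : T -> {ptws I -> F}) (l : {ptws I -> F}) :
  (forall i, (fun t => f t i) @ D --> l i) -> f @ D --> l.
Proof.
move=> fl; apply/cvg_sup => i A /= [_ [[B Bop <-] Bl BA]].
have Bl' : nbhs (l i) B by apply: open_nbhs_nbhs.
rewrite /=; have h : \forall t \near D, B (f t i) by exact: (fl i _ Bl').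
by apply: filterS h => t Bt; apply: BA.
Qed.

(** For continuity [Ck_on] packs the directions into a function on ['I_1]; the map
    from a direction to the constant function recovers joint continuity. *)
Lemma Ck_on_strict_deriv {F E : tvsType R} (k : option nat) (U : set F)
    (f : F -> E) x v : le_order 1 k -> nbhs x U -> Ck_on k U f ->
  strict_deriv f x v (dderive f x v).
Proof.
move=> k1 xU [fD fC]; apply: C1_strict_deriv.
  by apply: filterS xU => y Uy w; apply: dderiveP; exact: (fD [::]).
pose T := {ptws 'I_1 -> F}.
pose G (z : F * T) := iter_dderive f [seq z.2 i | i <- enum 'I_1] z.1.
have GC : {for (x, (fun=> v) : T), continuous G}.
  exact: (fC 1%N k1 x (fun=> v) (nbhs_singleton xU)).
have hc : {for (x, v), continuous (fun z : F * F => (z.1, (fun=> z.2) : T))}.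
  apply: (cvg_to_prod (G := nbhs x) (H := nbhs ((fun=> v) : T))).
    exact: cvg_fst.
  by apply: ptws_cvg => i; exact: cvg_snd.
have := @continuous_comp _ _ _ (fun z : F * F => (z.1, (fun=> z.2) : T)) G (x, v) hc GC.
by rewrite /G /comp /= enum_ordSl /= enum_ord0.
Qed.

(** The derivative of [(y, v) |-> D_v f (y)] in the direction [(h, k)] is
    [D_h D_v f (y) + D_k f (y)]: the increment in the direction slot is exact,
    because directional derivatives are linear in the direction. *)
Lemma Ck_on_C2_at {F E : tvsType R} (U : set F) (f : F -> E) x :
  hausdorff_space E -> nbhs x U -> Ck_on None U f -> C2_at f x.
Proof.
move=> hE xU Cf; have [fD fC] := Cf.
pose D2 y v h := dderive (dderive f ^~ v) y h.
exists (dderive f), (fun y v w => D2 y v w.1 + dderive f y w.2).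
have s1 : \forall y \near x, forall v, strict_deriv f y v (dderive f y v).
  apply: filterS (near_join xU) => y yU v; exact: (@Ck_on_strict_deriv _ _ None U).
apply: filterS2 (near_join xU) (near_join s1) => y yU sy; split.
  exact: (nbhs_singleton sy).
move=> v w.
have add a u u' : U a -> (forall v, strict_deriv f a v (dderive f a v)) ->
    dderive f a (u + u') = dderive f a u + dderive f a u'.
  move=> Ua sa; apply: strict_dderive => //; apply: strict_deriv_dirD; exact: sa.
have scale a u (t : R) : (forall v, strict_deriv f a v (dderive f a v)) ->
    dderive f a (t *: u) = t *: dderive f a u.
  move=> sa; apply: dderive_eq => //; apply: is_dderiveZ.
  exact: strict_is_dderive.
apply: (@C1_strict_deriv _ _ _ (fun z : F * F => dderive f z.1 z.2)
  (fun z w => D2 z.1 z.2 w.1 + dderive f z.1 w.2) (y, v) w).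
  have h1 : \forall z \near (y, v), (\forall b \near z.1, U b) /\
     (\forall a \near z.1, forall u, strict_deriv f a u (dderive f a u)).
    have h0 : \forall a \near y, (\forall b \near a, U b) /\
       (\forall b \near a, forall u, strict_deriv f b u (dderive f b u)).
      by apply: filterI; exact: near_join.
    exact: (@cvg_fst _ _ (nbhs y) (nbhs v) _ _ h0).
  apply: filterS h1 => -[a u] /= [aU sa] [h k] /=.
  have d1 : is_dderive (dderive f ^~ u) a h (D2 a u h).
    apply: dderiveP; exact: (fD [:: u] h a isT (nbhs_singleton aU)).
  have ca : (fun t : R => a + t *: h) @ (0 : R)^' --> a.
    rewrite -[X in _ --> X]addr0 -(scale0r h).
    apply: tvs_cvgD; first exact: cvg_cst.
    by apply: tvs_cvgZ; [exact: nbhs_dnbhs | exact: cvg_cst].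
  have d2 : (fun t : R => dderive f (a + t *: h) k) @ (0 : R)^' --> dderive f a k.
    have ck : (fun t : R => (a + t *: h, k)) @ (0 : R)^' --> (a, k).
      exact: (cvg_to_prod (G := nbhs a) (H := nbhs k) ca (cvg_cst k)).
    exact: (cvg_comp _ _ ck (@strict_deriv_contD _ _ _ f (dderive f) a k sa)).
  apply: (cvg_near_eq _ (tvs_cvgD d1 d2)).
  have U1 : \forall t \near (0 : R)^', U (a + t *: h) by exact: (ca _ aU).
  have U2 : \forall t \near (0 : R)^', forall v,
      strict_deriv f (a + t *: h) v (dderive f (a + t *: h) v) by exact: (ca _ sa).
  apply: filterS3 U1 U2 (@nbhs_dnbhs_neq _ (0 : R)) => t u1 u2 t0.
  rewrite /diff_quot /= add// scale// [in RHS]addrAC [in RHS]scalerDr [in RHS]scalerA mulVf//.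
  by rewrite scale1r.
have cD2 : {for ((y, v), w), continuous
    (fun z : (F * F) * (F * F) => D2 z.1.1 z.1.2 z.2.1)}.
  pose T := {ptws 'I_2 -> F}.
  pose dir (z : (F * F) * (F * F)) : T := fun i => if i == ord0 then z.1.2 else z.2.1.
  pose G (z : F * T) := iter_dderive f [seq z.2 i | i <- enum 'I_2] z.1.
  have GC : {for (y, dir ((y, v), w)), continuous G}.
    exact: (fC 2%N isT y (dir ((y, v), w)) (nbhs_singleton yU)).
  have hc : {for ((y, v), w), continuous (fun z => (z.1.1, dir z))}.
    apply: (cvg_to_prod (G := nbhs y) (H := nbhs (dir ((y, v), w)))).
      exact: (cvg_comp _ _ cvg_fst cvg_fst).
    apply: ptws_cvg => i; rewrite /dir; case: (i == ord0).
      exact: (cvg_comp _ _ cvg_fst cvg_snd).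
    exact: (cvg_comp _ _ cvg_snd cvg_fst).
  have := @continuous_comp _ _ _ (fun z => (z.1.1, dir z)) G ((y, v), w) hc GC.
  by rewrite /G /comp /= !enum_ordSl /= enum_ord0.
have cD1 : {for ((y, v), w), continuous
    (fun z : (F * F) * (F * F) => dderive f z.1.1 z.2.2)}.
  have ck : (fun z : (F * F) * (F * F) => (z.1.1, z.2.2)) @ ((y, v), w) --> (y, w.2).
    apply: (cvg_to_prod (G := nbhs y) (H := nbhs w.2)).
      exact: (cvg_comp _ _ cvg_fst cvg_fst).
    exact: (cvg_comp _ _ cvg_snd cvg_snd).
  exact: (cvg_comp _ _ ck (@strict_deriv_contD _ _ _ f (dderive f) y w.2 sy)).
exact: (tvs_cvgD cD2 cD1).
Qed.

End C2.

(** * Second derivatives commute *)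

Section MixedDerivatives.
Context {R : realType} {F E : tvsType R}.

Lemma strict_deriv_Ck_on1 (U : set F) (f : F -> E) : open U ->
  (forall x v, U x -> strict_deriv f x v (dderive f x v)) -> Ck_on (Some 1%N) U f.
Proof.
move=> Uo fU.
have near_fU x : U x -> \forall y \near x, forall w, strict_deriv f y w (dderive f y w).
  move=> Ux; have : \forall y \near x, U y by exact: open_nbhs_nbhs.
  by apply: filterS => y Uy w; exact: fU.
split=> [[|//] v x _ Ux|]; first by exists (dderive f x v); apply: strict_is_dderive; exact: fU.
case=> [_ x v Ux|[_ x v Ux|//]].
  rewrite enum_ord0 /=; apply: (@continuous_comp _ _ _ fst f); first exact: cvg_fst.
  exact: strict_deriv_continuous (fU x 0 Ux).
rewrite enum_ordSl enum_ord0 /=.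
have h := @strict_deriv_contD _ _ _ f (dderive f) x (v ord0) (near_fU x Ux).
apply: (@continuous_comp _ _ _ (fun z : F * {ptws 'I_1 -> F} => (z.1, z.2 ord0))
  (fun z : F * F => dderive f z.1 z.2)); last exact: h.
apply: (cvg_to_prod (G := nbhs x) (H := nbhs (v ord0))); first exact: cvg_fst.
have pC : (fun w : {ptws 'I_1 -> F} => w ord0) @ v --> v ord0.
  exact: (@proj_continuous 'I_1 (fun=> F) ord0 v).
have sC : (@snd F {ptws 'I_1 -> F}) @ (x, v) --> v by exact: cvg_snd.
exact: (cvg_comp _ _ sC pC).
Qed.

Lemma is_dderive_shift (f : F -> E) (c x v : F) (l : E) :
  is_dderive f (x + c) v l -> is_dderive (fun y => f (y + c)) x v l.
Proof.
move=> h; apply: (cvg_dnbhs0_eq _ h) => t t0; rewrite /diff_quot.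
by rewrite [in RHS]addrAC.
Qed.

(** The second difference is the increment of [y |-> f (y + t u) - f y] along
    [t v]; the derivative of this function is [t] times a difference quotient of
    [df ^~ v] in the direction [u]. *)
Lemma second_difference (p : cont_seminorm E) (f : F -> E) (df : F -> F -> E) (x u v : F) (l : E)
    (e : R) : 0 < e ->
  (\forall y \near x, forall w, strict_deriv f y w (df y w)) ->
  strict_deriv (df ^~ v) x u l ->
  \forall t \near (0 : R)^',
    p (f (x + t *: v + t *: u) - f (x + t *: v) - (f (x + t *: u) - f x)
       - (t * t) *: l) <= t * t * e.
Proof.
move=> e0 fdf dfl; have [[P Q] /= [Pxu Q0] PQ] := cvg_seminorm_lt p dfl e0.
have [[A B] /= [Ax Bu] AB] := Pxu.
have [q qA] := seminorm_nbhs (filterI Ax fdf).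
have quv0 : 0 < q v + q u + 1 by rewrite ltr_pwDr// addr_ge0// seminorm_ge0.
have N1 : \forall t \near (0 : R)^', `|t| < (q v + q u + 1)^-1.
  exists (q v + q u + 1)^-1; first by rewrite /= invr_gt0.
  by move=> t /=; rewrite sub0r normrN.
apply: filterS3 N1 Q0 (@nbhs_dnbhs_neq _ (0 : R)) => t t1 Qt t0.
have tq : `|t| * (q v + q u) < 1.
  have [->|nt0] := eqVneq (q v + q u) 0; first by rewrite mulr0.
  have : `|t| * (q v + q u + 1) < 1 by rewrite -ltr_pdivlMr// div1r.
  by rewrite mulrDr mulr1; have := normr_ge0 t; lra.
pose g (y : F) : E := f (y + t *: u) - f y.
have -> : f (x + t *: v + t *: u) - f (x + t *: v) - (f (x + t *: u) - f x) =
  g (x + t *: v) - g x by [].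
apply: mean_value_line => s /andP[s0 s1].
have stv : q (s *: (t *: v)) <= `|t| * q v.
  rewrite !seminormZ ger0_norm// ler_piMl// mulr_ge0// seminorm_ge0.
  by [].
have [|As fs] := qA (x + s *: (t *: v)).
  rewrite [x + _]addrC addrK; apply: (le_lt_trans stv); apply: (le_lt_trans _ tq).
  by rewrite ler_wpM2l// lerDl seminorm_ge0.
have [|As' fs'] := qA (x + s *: (t *: v) + t *: u).
  rewrite -[x + _ + _]addrA [x + _]addrC addrK; apply: (le_lt_trans (seminormD q _ _)).
  by apply: (le_lt_trans _ tq); rewrite mulrDr lerD// seminormZ.
set y := x + s *: (t *: v) in As fs As' fs' *.
exists (t *: df (y + t *: u) v - t *: df y v).
  apply: is_dderiveB; last by apply: is_dderiveZ; exact: strict_is_dderive.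
  by apply: is_dderive_shift; apply: is_dderiveZ; exact: strict_is_dderive.
have -> : t *: df (y + t *: u) v - t *: df y v - (t * t) *: l =
    (t * t) *: (diff_quot (df ^~ v) y u t - l).
  rewrite scalerBr /diff_quot scalerA -mulrA divff// mulr1 scalerBr.
  by [].
rewrite seminormZ normrM -expr2 real_normK ?num_real// expr2 ler_wpM2l//.
  by rewrite -expr2 sqr_ge0.
apply: ltW; apply: (PQ ((y, u), t)); split => //; apply: (AB (y, u)); split => //=.
exact: nbhs_singleton.
Qed.

(** The second difference is symmetric in [u] and [v], and divided by [t^2] it
    converges to either mixed derivative. *)
Lemma mixed_deriv_sym (f : F -> E) (df : F -> F -> E) (x u v : F) (l m : E) :
  hausdorff_space E ->
  (\forall y \near x, forall w, strict_deriv f y w (df y w)) ->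
  strict_deriv (df ^~ v) x u l -> strict_deriv (df ^~ u) x v m -> l = m.
Proof.
move=> hE fdf dl dm; apply/eqP; rewrite -subr_eq0; apply/eqP.
apply: seminorm_eq0 => // p; apply/eqP; rewrite eq_le seminorm_ge0 andbT.
apply/ler_addgt0Pr => e e0; rewrite add0r.
have e20 : 0 < e / 2 by rewrite divr_gt0.
have h1 := second_difference p e20 fdf dl.
have h2 := second_difference p e20 fdf dm.
have h3 : \forall t \near (0 : R)^', p (l - m) <= e; last first.
  by have [t] := filter_ex h3.
apply: filterS3 h1 h2 (@nbhs_dnbhs_neq _ (0 : R)) => t k1 k2 t0.
have tt0 : 0 < t * t by rewrite -expr2 exprn_even_gt0.
rewrite -(ler_pM2l tt0) -{1}(gtr0_norm tt0) -seminormZ.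
set D1 := (X in p (X - _)) in k1; set D2 := (X in p (X - _)) in k2.
have D12 : D1 = D2.
  rewrite /D1 /D2 [x + t *: u + _]addrAC -!addrA; congr (_ + _).
  by rewrite !opprD !opprK addrCA.
have := seminorm_dist3 p D1 ((t * t) *: l) ((t * t) *: m).
rewrite -scalerBr (seminorm_distC p _ D1) {2}D12 => k3.
apply: (le_trans k3); apply: (le_trans (lerD k1 k2)).
by rewrite -mulrDr -splitr.
Qed.

End MixedDerivatives.

(** * Maps into a Lie group *)

Section C2Maps.
Context {R : realType} {E : tvsType R} {G : preTopologicalGroupType}.
Variables (A : set (chart G E)) (Xi : chart G E).
Hypotheses (hE : hausdorff_space E) (hG : is_lie_group A) (hXi : is_unit_chart A Xi).

Implicit Types (c d e : chart G E).

(** The fixed chart around the unit is only required to be compatible with the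
    atlas; adjoining it keeps charts compatible to the second order. *)
Definition admissible (c : chart G E) : Prop := A c \/ c = Xi.

Lemma admissible_Xi : admissible Xi. Proof. by right. Qed.

Lemma admissible_chart c : admissible c -> is_chart c.
Proof.
case: hG => _ [hA _ _] _ _; case: hXi => -[hX _] _ _ _.
by move=> [/hA|->].
Qed.

Lemma exists_chart g : exists2 c, A c & cdom c g.
Proof. by case: hG => _ [_ hA _] _ _; exact: hA. Qed.

Lemma chart_cbwdK c y : admissible c -> cimg c y -> cfwd c (cbwd c y) = y.
Proof. by move=> /admissible_chart[_ _ cK _ _] [x cx <-]; rewrite cK. Qed.

Lemma chart_cbwd_dom c y : admissible c -> cimg c y -> cdom c (cbwd c y).
Proof. by move=> /admissible_chart[_ _ cK _ _] [x cx <-]; rewrite cK. Qed.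

Lemma near_cdom c g : admissible c -> cdom c g -> \forall h \near g, cdom c h.
Proof. by move=> /admissible_chart[co _ _ _ _] cg; exact: open_nbhs_nbhs. Qed.

Lemma near_cimg c y : admissible c -> cimg c y -> \forall z \near y, cimg c z.
Proof. by move=> /admissible_chart[_ ci _ _ _] cy; exact: open_nbhs_nbhs. Qed.

Lemma cimg_cfwd c g : cdom c g -> cimg c (cfwd c g).
Proof. by move=> cg; exists g. Qed.

Lemma nbhs_cfwd c g (W : set G) : admissible c -> cdom c g -> nbhs g W ->
  nbhs (cfwd c g) (cfwd c @` (cdom c `&` W)).
Proof.
move=> ac cg Wg; have [_ _ cK _ cb] := admissible_chart ac.
have ci := cimg_cfwd cg.
have hW : nbhs (cbwd c (cfwd c g)) W by rewrite cK.
have h1 : \forall y \near cfwd c g, W (cbwd c y) by exact: (cb _ ci _ hW).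
apply: filterS2 h1 (near_cimg ac ci) => y Wy cy.
by exists (cbwd c y); [split => //; exact: chart_cbwd_dom | exact: chart_cbwdK].
Qed.

Lemma transition_C2 c d g : admissible c -> admissible d -> cdom c g -> cdom d g ->
  C2_at (cfwd d \o cbwd c) (cfwd c g).
Proof.
move=> ac ad cg dg.
case: hG => _ [hA _ compA] _ _; case: hXi => -[hX compX] _ _ _.
have nb := nbhs_cfwd ac cg (near_cdom ad dg).
have idC : c = d -> C2_at (cfwd d \o cbwd c) (cfwd c g).
  move=> <-; apply: C2_at_near (C2_at_id _).
  apply: filterS (near_cimg ac (cimg_cfwd cg)) => y cy /=.
  by rewrite chart_cbwdK.
case: (ac) => [Ac|cX]; case: (ad) => [Ad|dX].
- exact: Ck_on_C2_at hE nb (compA _ _ Ac Ad).1.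
- apply: (Ck_on_C2_at hE nb); rewrite dX setIC; exact: (compX _ Ac).2.
- by apply: (Ck_on_C2_at hE nb); rewrite cX; exact: (compX _ Ad).1.
- by apply: idC; rewrite cX dX.
Qed.

(** This class of maps into the group is closed under products and inverses, so
    charts at the individual factors occur only in the proofs of these two facts. *)
Definition C2_map_at {F : tvsType R} (f : F -> G) (x : F) : Prop :=
  {for x, continuous f} /\
  forall c, admissible c -> cdom c (f x) -> C2_at (cfwd c \o f) x.

Section Rules.
Context {F : tvsType R}.
Implicit Types (f g : F -> G) (x : F).

Lemma near_cdom_comp c f x : admissible c -> {for x, continuous f} ->
  cdom c (f x) -> \forall y \near x, cdom c (f y).
Proof. by move=> ac fC cfx; exact: (fC _ (near_cdom ac cfx)). Qed.

(** One chart around the image decides, since the transition maps are twice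
    differentiable. *)
Lemma C2_map_at_chart c f x : {for x, continuous f} -> admissible c ->
  cdom c (f x) -> C2_at (cfwd c \o f) x -> C2_map_at f x.
Proof.
move=> fC ac cfx Cf; split => // d ad dfx.
have := C2_at_comp Cf (transition_C2 ac ad cfx dfx).
apply: C2_at_near; apply: filterS (near_cdom_comp ac fC cfx) => y cy /=.
by have [_ _ cK _ _] := admissible_chart ac; rewrite cK.
Qed.

Lemma C2_map_at_cst (g : G) x : C2_map_at (fun=> g) x.
Proof. by split=> [|c ac cg]; [exact: cvg_cst | exact: C2_at_cst]. Qed.

Lemma C2_map_at_mul f g x : C2_map_at f x -> C2_map_at g x ->
  C2_map_at (fun y => f y * g y)%g x.
Proof.
move=> [fC fS] [gC gS]; case: hG => _ _ [mC mS] _.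
have fgC : {for x, continuous (fun y => f y * g y)%g}.
  have c1 : (fun y => (f y, g y)) @ x --> (f x, g x).
    exact: (cvg_to_prod (G := nbhs (f x)) (H := nbhs (g x)) fC gC).
  exact: (cvg_comp _ _ c1 (mC (f x, g x) I)).
have [c Ac cf] := exists_chart (f x); have [d Ad dg] := exists_chart (g x).
have [e Ae efg] := exists_chart (f x * g x)%g.
have [ac ad ae] : [/\ admissible c, admissible d & admissible e] by split; left.
apply: (@C2_map_at_chart e) => //.
have Cp : prod_atlas A A (prod_chart c d) by exists c, d.
have CC : C2_at (fun y => (cfwd c (f y), cfwd d (g y)) : (E * E)%type) x.
  by apply: C2_at_pair; [exact: fS | exact: gS].
have nb : nbhs (cfwd c (f x), cfwd d (g x))
   (cfwd (prod_chart c d) @` ([set: G * G] `&` cdom (prod_chart c d) `&`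
      (fun z : G * G => (z.1 * z.2)%g) @^-1` cdom e)).
  have := mC (f x, g x) I _ (near_cdom ae efg).
  move=> [[W1 W2] /= [W1f W2g] W12].
  exists (cfwd c @` (cdom c `&` W1), cfwd d @` (cdom d `&` W2)).
    by split; exact: nbhs_cfwd.
  move=> [_ _] /= [[u [cu W1u] <-] [w [dw W2w] <-]].
  exists (u, w) => //; split => //=; exact: (W12 (u, w)).
have := C2_at_comp CC (Ck_on_C2_at hE nb (mS _ _ Cp Ae)).
apply: C2_at_near.
apply: filterS2 (near_cdom_comp ac fC cf) (near_cdom_comp ad gC dg) => y cy dy /=.
have [_ _ cK _ _] := admissible_chart ac; have [_ _ dK _ _] := admissible_chart ad.
by rewrite cK// dK.
Qed.

Lemma C2_map_at_inv f x : C2_map_at f x -> C2_map_at (fun y => (f y)^-1)%g x.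
Proof.
move=> [fC fS]; case: hG => _ _ _ [mC mS].
have iC : {for x, continuous (fun y => (f y)^-1)%g}.
  exact: (cvg_comp _ _ fC (mC (f x) I)).
have [c Ac cf] := exists_chart (f x).
have [e Ae ef] := exists_chart (f x)^-1%g.
have [ac ae] : admissible c /\ admissible e by split; left.
apply: (@C2_map_at_chart e) => //.
have nb : nbhs (cfwd c (f x)) (cfwd c @` ([set: G] `&` cdom c `&`
      (fun z : G => (z^-1)%g) @^-1` cdom e)).
  rewrite setTI; apply: nbhs_cfwd => //.
  exact: (mC (f x) I _ (near_cdom ae ef)).
have := C2_at_comp (fS c ac cf) (Ck_on_C2_at hE nb (mS _ _ Ac Ae)).
apply: C2_at_near; apply: filterS (near_cdom_comp ac fC cf) => y cy /=.
by have [_ _ cK _ _] := admissible_chart ac; rewrite cK.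
Qed.

Lemma C2_map_at_comp {H : tvsType R} (f : H -> F) (g : F -> G) (x : H) :
  C2_at f x -> C2_map_at g (f x) -> C2_map_at (g \o f) x.
Proof.
move=> Cf [gC gS]; split.
  by apply: continuous_comp => //; exact: C2_at_continuous.
by move=> c ac cg; exact: (C2_at_comp Cf (gS c ac cg)).
Qed.

End Rules.

Lemma C2_map_at_cbwd c y : admissible c -> cimg c y -> C2_map_at (cbwd c) y.
Proof.
move=> ac cy; have [_ _ cK _ cb] := admissible_chart ac.
apply: (C2_map_at_chart (c := c)) => //; first exact: cb.
  exact: chart_cbwd_dom.
apply: C2_at_near (C2_at_id _).
by apply: filterS (near_cimg ac cy) => z cz /=; rewrite chart_cbwdK.
Qed.

End C2Maps.

(** * The adjoint representation and the bracket *)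

Section Slices.
Context {R : realType} {F H : tvsType R}.

Lemma strict_deriv_inr (x : F) (y v : H) :
  strict_deriv (fun y : H => (x, y) : (F * H)%type) y v (0, v).
Proof. by apply: strict_deriv_pair; [exact: strict_deriv_cst | exact: strict_deriv_id]. Qed.

Lemma strict_deriv_inl (x v : F) (y : H) :
  strict_deriv (fun x : F => (x, y) : (F * H)%type) x v (v, 0).
Proof. by apply: strict_deriv_pair; [exact: strict_deriv_id | exact: strict_deriv_cst]. Qed.

Arguments strict_deriv_inr x y v : clear implicits.
Arguments strict_deriv_inl x v y : clear implicits.

Lemma inr_continuous (x : F) (y : H) :
  {for y, continuous (fun y : H => (x, y) : (F * H)%type)}.
Proof. exact: strict_deriv_continuous (strict_deriv_inr x y 0). Qed.

Lemma inl_continuous (x : F) (y : H) :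
  {for x, continuous (fun x : F => (x, y) : (F * H)%type)}.
Proof. exact: strict_deriv_continuous (strict_deriv_inl x 0 y). Qed.

End Slices.

Arguments strict_deriv_inr {R F H} x y v.
Arguments strict_deriv_inl {R F H} x v y.
Arguments inr_continuous {R F H} x y.
Arguments inl_continuous {R F H} x y.

Section Adjoint.
Context {R : realType} {E : tvsType R} {G : preTopologicalGroupType}.
Variables (A : set (chart G E)) (Xi : chart G E).
Hypotheses (hE : hausdorff_space E) (hG : is_lie_group A) (hXi : is_unit_chart A Xi).
Implicit Types (g h : G) (X Y Z : E).

Local Notation aX := (admissible_Xi A Xi).
Local Notation C2_map_at := (C2_map_at A Xi).

Lemma Xi1 : cfwd Xi 1%g = 0. Proof. by case: hXi. Qed.

Lemma Xi_dom1 : cdom Xi 1%g. Proof. by case: hXi. Qed.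

Lemma Xi_img0 : cimg Xi 0. Proof. by rewrite -Xi1; exists 1%g => //; exact: Xi_dom1. Qed.

Lemma XiK g : cdom Xi g -> cbwd Xi (cfwd Xi g) = g.
Proof. by have [_ _ cK _ _] := admissible_chart hG hXi aX; exact: cK. Qed.

Lemma Xi_bwd0 : cbwd Xi 0 = 1%g. Proof. by rewrite -Xi1 XiK//; exact: Xi_dom1. Qed.

Lemma C2_map_bwd0 : C2_map_at (cbwd Xi) 0.
Proof. by apply: (C2_map_at_cbwd hE hG hXi); [exact: aX | exact: Xi_img0]. Qed.

Lemma C2_map_chart {F : tvsType R} (f : F -> G) x : C2_map_at f x -> cdom Xi (f x) ->
  C2_at (cfwd Xi \o f) x.
Proof. by move=> [_ h]; apply: h; exact: aX. Qed.

Lemma C2_map_near_dom {F : tvsType R} (f : F -> G) x : C2_map_at f x ->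
  cdom Xi (f x) -> \forall y \near x, cdom Xi (f y).
Proof. by move=> [fC _]; exact: (near_cdom_comp hG hXi aX fC). Qed.

Definition conj_plot g (y : E) : G := (g * cbwd Xi y * g^-1)%g.

Lemma conj_plot0 g : conj_plot g 0 = 1%g.
Proof. by rewrite /conj_plot Xi_bwd0 mulg1 mulgV. Qed.

Lemma C2_map_conj g : C2_map_at (conj_plot g) 0.
Proof.
apply: (C2_map_at_mul hE hG hXi); last exact: C2_map_at_cst.
apply: (C2_map_at_mul hE hG hXi); first exact: C2_map_at_cst.
exact: C2_map_bwd0.
Qed.

Lemma near_conj_dom g : \forall y \near 0, cdom Xi (conj_plot g y).
Proof.
apply: C2_map_near_dom; first exact: C2_map_conj.
by rewrite conj_plot0; exact: Xi_dom1.
Qed.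

Lemma Ad_strict_deriv g X : strict_deriv (cfwd Xi \o conj_plot g) 0 X (Ad Xi g X).
Proof.
have Cc : C2_at (cfwd Xi \o conj_plot g) 0.
  by apply: C2_map_chart; [exact: C2_map_conj | rewrite conj_plot0; exact: Xi_dom1].
have [h _] := nbhs_singleton (C2_at_dderive hE Cc).
by rewrite /Ad /tangent_map Xi1; exact: h.
Qed.

Arguments Ad_strict_deriv g X : clear implicits.

Lemma Ad1 X : Ad Xi 1%g X = X.
Proof.
apply: (strict_deriv_unique hE (Ad_strict_deriv 1%g X)).
apply: strict_deriv_near (strict_deriv_id _ _).
apply: filterS (near_cimg hG hXi aX Xi_img0) => y cy /=.
by rewrite /conj_plot mul1g invg1 mulg1 (chart_cbwdK hG hXi aX).
Qed.

(** Conjugations compose and fix the unit, so this is the chain rule in the chart. *)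
Lemma AdM g h X : Ad Xi (g * h)%g X = Ad Xi g (Ad Xi h X).
Proof.
apply: (strict_deriv_unique hE (Ad_strict_deriv (g * h)%g X)).
have c0 : (cfwd Xi \o conj_plot h) 0 = 0 by rewrite /= conj_plot0 Xi1.
have hC : {for 0, continuous (cfwd Xi \o conj_plot h)}.
  exact: strict_deriv_continuous (Ad_strict_deriv h 0).
have gd := Ad_strict_deriv g (Ad Xi h X); rewrite -{1}c0 in gd.
apply: strict_deriv_near (strict_deriv_comp hC (Ad_strict_deriv h X) gd).
apply: filterS (near_conj_dom h) => y dy /=.
by rewrite {1}/conj_plot XiK// /conj_plot invgM !mulgA.
Qed.

Definition chart_mul (z : E * E) : E := cfwd Xi (cbwd Xi z.1 * cbwd Xi z.2)%g.

Local Notation m := chart_mul.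
Local Notation dm := (dderive chart_mul).

Lemma C2_map_bwd1 : C2_map_at (fun z : E * E => cbwd Xi z.1) (0, 0).
Proof.
apply: (C2_map_at_comp (f := @fst E E) (g := cbwd Xi)); first exact: C2_at_fst.
exact: C2_map_bwd0.
Qed.

Lemma C2_map_bwd2 : C2_map_at (fun z : E * E => cbwd Xi z.2) (0, 0).
Proof.
apply: (C2_map_at_comp (f := @snd E E) (g := cbwd Xi)); first exact: C2_at_snd.
exact: C2_map_bwd0.
Qed.

Lemma chart_mul_C2 : C2_at m (0, 0).
Proof.
apply: (C2_map_chart (f := fun z : E * E => (cbwd Xi z.1 * cbwd Xi z.2)%g)).
  by apply: (C2_map_at_mul hE hG hXi); [exact: C2_map_bwd1 | exact: C2_map_bwd2].
by rewrite /= Xi_bwd0 mulg1; exact: Xi_dom1.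
Qed.

Lemma chart_conj_C2 : C2_at (fun z : E * E => cfwd Xi (conj_plot (cbwd Xi z.1) z.2)) (0, 0).
Proof.
apply: (C2_map_chart (f := fun z : E * E =>
  (cbwd Xi z.1 * cbwd Xi z.2 * (cbwd Xi z.1)^-1)%g)).
  apply: (C2_map_at_mul hE hG hXi).
    by apply: (C2_map_at_mul hE hG hXi); [exact: C2_map_bwd1 | exact: C2_map_bwd2].
  by apply: (C2_map_at_inv hE hG hXi); exact: C2_map_bwd1.
by rewrite /= Xi_bwd0 mulg1 mul1g invg1; exact: Xi_dom1.
Qed.

Lemma near_fst0 (P : E * E -> Prop) : (\forall z \near (0, 0), P z) ->
  \forall x \near (0 : E), P (x, 0).
Proof.
have c : (fun x : E => (x, 0 : E)) @ (0 : E) --> ((0, 0) : E * E).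
  exact: (cvg_to_prod (G := nbhs (0 : E)) (H := nbhs (0 : E)) cvg_id (cvg_cst _)).
by move=> h; exact: (c _ h).
Qed.

Lemma near_snd0 (P : E * E -> Prop) : (\forall z \near (0, 0), P z) ->
  \forall x \near (0 : E), P (0, x).
Proof.
have c : (fun x : E => (0 : E, x)) @ (0 : E) --> ((0, 0) : E * E).
  exact: (cvg_to_prod (G := nbhs (0 : E)) (H := nbhs (0 : E)) (cvg_cst _) cvg_id).
by move=> h; exact: (c _ h).
Qed.

Lemma near_strict_mul : \forall z \near (0, 0), forall v, strict_deriv m z v (dm z v).
Proof. by apply: filterS (C2_at_dderive hE chart_mul_C2) => z []. Qed.

Lemma left_fieldE Y : \forall x \near (0 : E), left_field Xi Y x = dm (x, 0) (0, Y).
Proof.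
apply: filterS (near_fst0 near_strict_mul) => x h.
rewrite /left_field /tangent_map Xi1; apply: strict_dderive => //.
exact: (strict_deriv_comp (inr_continuous x 0) (strict_deriv_inr x 0 Y) (h (0, Y))).
Qed.

Lemma dmul_r Z : dm (0, 0) (0, Z) = Z.
Proof.
have h := nbhs_singleton near_strict_mul (0, Z).
have := strict_deriv_comp (inr_continuous 0 0) (strict_deriv_inr 0 0 Z) h.
move=> /(strict_deriv_unique hE); apply.
apply: strict_deriv_near (strict_deriv_id _ _).
apply: filterS (near_cimg hG hXi aX Xi_img0) => y cy /=.
by rewrite /chart_mul /= Xi_bwd0 mul1g (chart_cbwdK hG hXi aX).
Qed.

Lemma dmul_l Z : dm (0, 0) (Z, 0) = Z.
Proof.
have h := nbhs_singleton near_strict_mul (Z, 0).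
have := strict_deriv_comp (inl_continuous 0 0) (strict_deriv_inl 0 Z 0) h.
move=> /(strict_deriv_unique hE); apply.
apply: strict_deriv_near (strict_deriv_id _ _).
apply: filterS (near_cimg hG hXi aX Xi_img0) => y cy /=.
by rewrite /chart_mul /= Xi_bwd0 mulg1 (chart_cbwdK hG hXi aX).
Qed.

Lemma dmul_strict (v w : E * E) : exists l, strict_deriv (dm ^~ v) (0, 0) w l.
Proof.
have [_ /(_ v (w, 0))[l hl]] := nbhs_singleton (C2_at_dderive hE chart_mul_C2).
exists l; exact: (strict_deriv_comp (inl_continuous (0, 0) v)
  (strict_deriv_inl (0, 0) w v) hl).
Qed.

(** The left invariant field of [Y] is [x |-> dm (x, 0) (0, Y)] near the unit, so
    its derivative is a mixed second derivative of the multiplication. *)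
Lemma bracketE Z Y r r' :
  strict_deriv (dm ^~ (0, Y)) (0, 0) (Z, 0) r ->
  strict_deriv (dm ^~ (0, Z)) (0, 0) (Y, 0) r' ->
  bracket Xi Z Y = r - r'.
Proof.
move=> hr hr'; rewrite /bracket Xi1.
rewrite (nbhs_singleton (left_fieldE Z)) (nbhs_singleton (left_fieldE Y)) !dmul_r.
have field X W q : strict_deriv (dm ^~ (0, X)) (0, 0) (W, 0) q ->
    dderive (left_field Xi X) 0 W = q.
  move=> hq; apply: strict_dderive => //.
  have := strict_deriv_comp (inl_continuous 0 0) (strict_deriv_inl 0 W 0) hq.
  by apply: strict_deriv_near; apply: filterS (left_fieldE X) => x ->.
by rewrite (field _ _ _ hr) (field _ _ _ hr').
Qed.

Lemma Ad_chartE Y : \forall x \near (0 : E), Ad Xi (cbwd Xi x) Y =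
  dderive (fun z : E * E => cfwd Xi (conj_plot (cbwd Xi z.1) z.2)) (x, 0) (0, Y).
Proof.
apply: filterS (near_fst0 (C2_at_dderive hE chart_conj_C2)) => x [h _].
apply: (strict_deriv_unique hE (Ad_strict_deriv _ Y)).
exact: (strict_deriv_comp (inr_continuous x 0) (strict_deriv_inr x 0 Y) (h (0, Y))).
Qed.

(** The derivative in [y] at the unit of [(x y x^-1) x = x y]. *)
Lemma Ad_mul_identity Y : \forall x \near (0 : E),
  dm (0, x) (Ad Xi (cbwd Xi x) Y, 0) = dm (x, 0) (0, Y).
Proof.
apply: filterS2 (near_fst0 near_strict_mul) (near_snd0 near_strict_mul) => x h1 h2.
pose k (y : E) : (E * E)%type := ((cfwd Xi \o conj_plot (cbwd Xi x)) y, x).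
have kd u : strict_deriv k 0 u (Ad Xi (cbwd Xi x) u, 0).
  by apply: strict_deriv_pair; [exact: Ad_strict_deriv | exact: strict_deriv_cst].
have k0 : k 0 = (0, x) by rewrite /k /= conj_plot0 Xi1.
have kC : {for 0, continuous k} by exact: strict_deriv_continuous (kd 0).
rewrite -k0 in h2.
have d1 := strict_deriv_comp kC (kd Y) (h2 _).
have d2 := strict_deriv_comp (inr_continuous x 0) (strict_deriv_inr x 0 Y) (h1 (0, Y)).
rewrite -k0; apply: (strict_deriv_unique hE d1).
apply: strict_deriv_near d2.
apply: filterS (near_conj_dom (cbwd Xi x)) => y dy /=.
by rewrite /chart_mul /= XiK// /conj_plot mulgVK.
Qed.

(** Differentiating the preceding identity in [x] along [Z] gives
    [s + a' = r], where [a'] is the derivative sought, [r] and [s] are mixed second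
    derivatives of the multiplication, and [s] is the second term of the bracket
    by symmetry. *)
Lemma Ad_bracket Y Z :
  strict_deriv (fun x => Ad Xi (cbwd Xi x) Y) 0 Z (bracket Xi Z Y).
Proof.
have Ad_deriv u : exists l, strict_deriv (fun x => Ad Xi (cbwd Xi x) Y) 0 u l.
  have [_ /(_ (0, Y) ((u, 0), (0, 0)))[l hl]] :=
    nbhs_singleton (C2_at_dderive hE chart_conj_C2).
  exists l.
  pose k (x : E) : (E * E) * (E * E) := ((x, 0), (0, Y)).
  have kd v : strict_deriv k 0 v ((v, 0), (0, 0)).
    by apply: strict_deriv_pair; [exact: strict_deriv_inl | exact: strict_deriv_cst].
  have kC : {for 0, continuous k} by exact: strict_deriv_continuous (kd 0).
  have := strict_deriv_comp kC (kd u) hl.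
  by apply: strict_deriv_near; apply: filterS (Ad_chartE Y) => x ->.
have [a' ha'] := Ad_deriv Z.
suff -> : bracket Xi Z Y = a' by [].
(* [r], [s] and [r'] are the three mixed second derivatives that occur; [s = r']. *)
have [r hr] := dmul_strict (0, Y) (Z, 0).
have [r' hr'] := dmul_strict (0, Z) (Y, 0).
have [s hs] := dmul_strict (Y, 0) (0, Z).
rewrite (bracketE hr hr') -(mixed_deriv_sym hE near_strict_mul hs hr').
have [_ dm2] := nbhs_singleton (C2_at_dderive hE chart_mul_C2).
(* The derivative of the left-hand side splits into the variation [l1 = s] of
   the base point and the variation [l2 = a'] of the direction, in which [dm] at
   the unit is the identity. *)
have [l1 hl1] := dm2 (Y, 0) ((0, Z), (0, 0)).
have [l2 hl2] := dm2 (Y, 0) ((0, 0), (a', 0)).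
have l1s : l1 = s.
  apply: (strict_deriv_unique hE _ hs).
  exact: (strict_deriv_comp (inl_continuous (0, 0) (Y, 0))
    (strict_deriv_inl (0, 0) (0, Z) (Y, 0)) hl1).
have l2a : l2 = a'.
  pose k (w : E) : (E * E) * (E * E) := ((0, 0), (w, 0)).
  have kd y u : strict_deriv k y u ((0, 0), (u, 0)).
    by apply: strict_deriv_pair; [exact: strict_deriv_cst | exact: strict_deriv_inl].
  have kC : {for Y, continuous k} by exact: strict_deriv_continuous (kd Y 0).
  have := strict_deriv_comp kC (kd Y a') hl2.
  move=> /(strict_deriv_unique hE); apply.
  apply: strict_deriv_near (strict_deriv_id _ _).
  by apply: nearW => w; rewrite /= dmul_l.
have hl := strict_deriv_dirD hl1 hl2.
rewrite {}l1s {}l2a in hl.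
have e12 : ((0, Z), (0, 0)) + ((0, 0), (a', 0)) = ((0, Z), (a', 0)) :> (E * E) * (E * E).
  by congr ((_, _), (_, _)); rewrite /= ?addr0 ?add0r.
rewrite e12 in hl.
pose k (x : E) : (E * E) * (E * E) := ((0, x), (Ad Xi (cbwd Xi x) Y, 0)).
have kd u l : strict_deriv (fun x => Ad Xi (cbwd Xi x) Y) 0 u l ->
    strict_deriv k 0 u ((0, u), (l, 0)).
  move=> hul; apply: strict_deriv_pair; first exact: strict_deriv_inr.
  by apply: strict_deriv_pair; [exact: hul | exact: strict_deriv_cst].
have k0 : k 0 = ((0, 0), (Y, 0)) by rewrite /k Xi_bwd0 Ad1.
have kC : {for 0, continuous k}.
  by have [l0 /kd] := Ad_deriv 0; exact: strict_deriv_continuous.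
rewrite -k0 in hl.
have d1 := strict_deriv_comp kC (kd _ _ ha') hl.
have d2 := strict_deriv_comp (inl_continuous 0 0) (strict_deriv_inl 0 Z 0) hr.
have d3 := strict_deriv_near (Ad_mul_identity Y) d1.
have := strict_deriv_unique hE d3 d2.
by move=> <-; rewrite addrC addKr.
Qed.

End Adjoint.

(** * Product integrals *)

Section ProductIntegral.
Context {R : realType} {E : tvsType R} {G : preTopologicalGroupType}.
Variables (A : set (chart G E)) (Xi : chart G E).
Hypotheses (hE : hausdorff_space E) (hG : is_lie_group A) (hXi : is_unit_chart A Xi).
Implicit Types (g h : G) (X Y Z : E) (mu : R^o -> G) (w : cont_seminorm E).

Lemma chart_atP g : A (chart_at A Xi g) /\ cdom (chart_at A Xi g) g.
Proof.
have [c Ac cg] := exists_chart hG g.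
exact: (@xgetPex _ Xi [set c | A c /\ cdom c g] (ex_intro _ c (conj Ac cg))).
Qed.

(** What the theory needs of a curve at a given time; the line segments in the chart
    satisfy it as well as the restrictions of C^1-curves. *)
Definition regular_at mu (t : R^o) : Prop :=
  {for t, continuous mu} /\
  strict_deriv (cfwd (chart_at A Xi (mu t)) \o mu : R^o -> E) t 1
    (velocity A Xi mu t).

Lemma Ck_ext_regular (a b : R) mu (t : R) : Ck_ext_G A (Some 1%N) a b mu ->
  t \in `[a, b] -> regular_at mu t.
Proof.
move=> [I [Io _ abI [muC muS]]] tab.
have It : I t by apply: abI.
have muCt : {for (t : R^o), continuous mu} by exact: muC.
split => //; have [Ac ct] := chart_atP (mu t).
have ac : admissible A Xi (chart_at A Xi (mu t)) by left.
have := muS (Chart setT id id) _ erefl Ac.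
apply: Ck_on_strict_deriv => //.
have h1 := near_cdom_comp hG hXi ac muCt ct.
have h2 : \forall s \near (t : R^o), I s by exact: open_nbhs_nbhs.
by apply: filterS2 h1 h2 => s cs Is; exists s.
Qed.

Lemma primitive_regular (a b : R) (phi : R -> E) mu (t : R) :
  primitive A Xi a b phi mu -> a <= t <= b ->
  regular_at mu t /\ phi t = rlogder A Xi mu t.
Proof.
move=> [muC phiE] tab; have tI : t \in `[a, b] by rewrite in_itv.
by split; [exact: Ck_ext_regular tI | exact: phiE].
Qed.

(** The logarithmic derivative, defined through an arbitrary chart at [mu t], is
    the velocity at the unit of the translated curve [s |-> mu s (mu t)^-1]. *)
Lemma rlogder_strict mu (t : R^o) : regular_at mu t ->
  strict_deriv (fun s : R^o => cfwd Xi (mu s * (mu t)^-1)%g) t 1 (rlogder A Xi mu t).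
Proof.
move=> [muC mud]; have [Ac ct] := chart_atP (mu t).
set c := chart_at A Xi (mu t) in Ac ct mud *.
have ac : admissible A Xi c by left.
have [_ _ cK _ _] := admissible_chart hG hXi ac.
have kS : C2_map_at A Xi (fun y => cbwd c y * (mu t)^-1)%g (cfwd c (mu t)).
  apply: (C2_map_at_mul hE hG hXi); last exact: C2_map_at_cst.
  by apply: (C2_map_at_cbwd hE hG hXi) => //; exact: cimg_cfwd.
have k1 : cdom Xi (cbwd c (cfwd c (mu t)) * (mu t)^-1)%g.
  by rewrite cK// mulgV; exact: (Xi_dom1 hXi).
have kC2 := C2_map_chart kS k1.
have [kd _] := nbhs_singleton (C2_at_dderive hE kC2).
have cC : {for t, continuous (cfwd c \o mu)}.
  exact: is_dderive_continuous_curve (strict_is_dderive mud).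
have := strict_deriv_comp cC mud (kd _).
apply: strict_deriv_near.
apply: filterS (near_cdom_comp hG hXi ac muC ct) => s cs /=.
by rewrite cK.
Qed.

(** Near [t] one has [mu s = (mu s (mu t)^-1) mu t], and the first factor passes
    through the unit with velocity [rlogder A Xi mu t]; multiplicativity of [Ad] reduces
    the claim to the derivative of [Ad] at the unit. *)
Lemma Ad_curve_deriv mu (t : R^o) X : regular_at mu t ->
  strict_deriv (fun s : R^o => Ad Xi (mu s) X) t 1
    (bracket Xi (rlogder A Xi mu t) (Ad Xi (mu t) X)).
Proof.
move=> mut; have nd := rlogder_strict mut; have [muC _] := mut.
pose n (s : R^o) : E := cfwd Xi (mu s * (mu t)^-1)%g.
have nC : {for t, continuous n}.
  exact: is_dderive_continuous_curve (strict_is_dderive nd).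
have n0 : n t = 0 by rewrite /n mulgV (Xi1 hXi).
have ad : strict_deriv (fun x => Ad Xi (cbwd Xi x) (Ad Xi (mu t) X)) 0
    (rlogder A Xi mu t) (bracket Xi (rlogder A Xi mu t) (Ad Xi (mu t) X)).
  exact: (Ad_bracket hE hG hXi).
rewrite -n0 in ad.
have := strict_deriv_comp nC nd ad; apply: strict_deriv_near.
have muS : {for t, continuous (fun s => mu s * (mu t)^-1)%g}.
  case: (hG) => _ _ [mC _] _.
  have c1 : (fun s => (mu s, (mu t)^-1)%g) @ t --> (mu t, (mu t)^-1)%g.
    exact: (cvg_to_prod (G := nbhs (mu t)) (H := nbhs (mu t)^-1%g) muC (cvg_cst _)).
  exact: (cvg_comp _ _ c1 (mC (mu t, (mu t)^-1)%g I)).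
have d1 : cdom Xi (mu t * (mu t)^-1)%g by rewrite mulgV; exact: (Xi_dom1 hXi).
apply: filterS (near_cdom_comp hG hXi (admissible_Xi A Xi) muS d1) => s ds /=.
by rewrite /n (XiK hG hXi)// -(AdM hE hG hXi) mulgVK.
Qed.

Section Growth.
Variables (w : cont_seminorm E) (C : R).
Hypotheses (hw : forall X Y, w (bracket Xi X Y) <= w X * w Y) (C0 : 0 <= C).

Lemma Ad_gronwall mu (a b : R) X : a <= b ->
  (forall t, a <= t <= b -> regular_at mu t) ->
  (forall t, a < t < b -> w (rlogder A Xi mu t) <= C) ->
  w (Ad Xi (mu b) X) <= expR (C * (b - a)) * w (Ad Xi (mu a) X) /\
  w (Ad Xi (mu a) X) <= expR (C * (b - a)) * w (Ad Xi (mu b) X).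
Proof.
move=> ab muR muC.
pose eta (s : R^o) := Ad Xi (mu s) X.
have etaC t : a <= t <= b -> {for t, continuous eta}.
  move=> tab; apply: is_dderive_continuous_curve (strict_is_dderive _).
  exact: (@Ad_curve_deriv mu t X (muR t tab)).
have etaD t : a < t < b -> exists2 l, is_dderive eta t 1 l & w l <= C * w (eta t).
  move=> tab; have tab' : a <= t <= b by case/andP: tab => /ltW -> /ltW ->.
  eexists; first exact: strict_is_dderive (@Ad_curve_deriv mu t X (muR t tab')).
  apply: (le_trans (hw _ _)); apply: ler_wpM2r; first exact: seminorm_ge0.
  exact: muC.
by split; [exact: (seminorm_gronwall (eta := eta))
          | exact: (seminorm_gronwall_rev (eta := eta))].
Qed.

(** The inverse of the product integral is [mu a (mu s)^-1], so the backward
    inequality applied to [Ad_((mu s)^-1) X] gives a bound in terms of [w o phi]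
    only. It holds for whichever primitive is selected. *)
Lemma prod_int_bound (a b : R) (phi : R -> E) (s : R) X :
  integrable_on A Xi a b phi -> a <= s <= b ->
  (forall t, a < t < b -> w (phi t) <= C) ->
  w (Ad Xi (prod_int A Xi a b phi s)^-1%g X) <= expR (C * (s - a)) * w X.
Proof.
move=> phiI /andP[as_ sb] phiC; rewrite /prod_int.
have := @xgetPex _ (fun=> 1%g) [set mu | primitive A Xi a b phi mu] phiI.
set mu := xget _ _ => /= muP.
have sub t : a <= t <= s -> a <= t <= b.
  by move=> /andP[-> /le_trans]; apply.
rewrite invgM invgK (AdM hE hG hXi); set Y := Ad Xi (mu s)^-1%g X.
have -> : X = Ad Xi (mu s) Y by rewrite /Y -(AdM hE hG hXi) mulgV (Ad1 hE hG hXi).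
apply: (Ad_gronwall Y as_ _ _).2.
  by move=> t /sub tab; have [] := primitive_regular muP tab.
move=> t /andP[at_ ts]; have tab : a <= t <= b by rewrite (ltW at_) (le_trans (ltW ts)).
have [_ <-] := primitive_regular muP tab; apply: phiC.
by rewrite at_ (lt_le_trans ts).
Qed.

Lemma decomp_mono (phi : R -> E) n t phis p : DP0_decomp A Xi phi n t phis ->
  (p <= n)%N -> 0 <= t p <= 1.
Proof.
move=> D pn; apply/andP; split.
  elim: p pn => [|p IHp] pn; first by rewrite (decomp_start D).
  by apply: (le_trans (IHp (ltnW pn))); apply/ltW/(decomp_lt D).
have le_add k : (p + k <= n)%N -> t p <= t (p + k)%N.
  elim: k => [|k IHk]; first by rewrite addn0.
  rewrite addnS => pk; apply: (le_trans (IHk (ltnW pk))).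
  by apply/ltW/(decomp_lt D).
by have := le_add (n - p)%N; rewrite subnKC// (decomp_end D); apply.
Qed.

(** The exponents [C (t p.+1 - t p)] of the pieces add up to at most [C],
    independently of the decomposition. A curve without product integral
    is assigned the constant 1, for which the bound is trivial. *)
Lemma DP0_prod_int_bound (phi : R -> E) (s : R) X :
  (forall t, 0 <= t <= 1 -> w (phi t) <= C) -> 0 <= s <= 1 ->
  w (Ad Xi (DP0_prod_int A Xi phi s)^-1%g X) <= expR C * w X.
Proof.
move=> phiC /andP[s0 s1].
have eC1 : w X <= expR C * w X.
  by rewrite ler_peMl ?seminorm_ge0// -expR0 ler_expR.
rewrite /DP0_prod_int; case: xgetP => [P _ [n [t [phis [D P0 PE]]]]|_]; last first.
  by rewrite invg1 (Ad1 hE hG hXi).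
have [->|sN0] := eqVneq s 0; first by rewrite P0 invg1 (Ad1 hE hG hXi).
have {}s0 : 0 < s by rewrite lt_neqAle eq_sym sN0.
have piece p u Z : (p < n)%N -> t p <= u <= t p.+1 ->
    w (Ad Xi (prod_int A Xi (t p) (t p.+1) (phis p) u)^-1%g Z) <=
      expR (C * (u - t p)) * w Z.
  move=> pn up; apply: prod_int_bound => //; first exact: decomp_int D p pn.
  move=> v /andP[v1 v2]; rewrite -(decomp_eq D pn) ?in_itv/= ?v1 ?v2//.
  have /andP[p0 _] := decomp_mono D (ltnW pn).
  have /andP[_ p1] := decomp_mono D pn.
  by apply: phiC; rewrite (le_trans p0 (ltW v1)) (le_trans (ltW v2)).
have upto p Z : (p <= n)%N ->
    w (Ad Xi (prod_int_upto A Xi t phis p)^-1%g Z) <= expR (C * t p) * w Z.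
  elim: p Z => [|p IHp] Z pn /=.
    by rewrite (decomp_start D) mulr0 expR0 mul1r invg1 (Ad1 hE hG hXi).
  rewrite invgM (AdM hE hG hXi); apply: (le_trans (IHp _ (ltnW pn))).
  have := piece p (t p.+1) Z pn.
  rewrite lexx (ltW (decomp_lt D pn)) => /(_ isT) h.
  have -> : expR (C * t p.+1) = expR (C * t p) * expR (C * (t p.+1 - t p)).
    by rewrite -expRD; congr expR; ring.
  by rewrite -mulrA ler_wpM2l// expR_ge0.
(* The piece that contains [s] ends at the first node at or after [s]. *)
have ex : exists p, s <= t p by exists n; rewrite (decomp_end D).
have [p sp pmin] := ex_minnP ex.
case: p => [|p] in sp pmin *; first by move: sp; rewrite (decomp_start D) leNgt s0.
have tps : t p < s by rewrite ltNge; apply/negP => /pmin; rewrite ltnn.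
have pn : (p < n)%N by apply: pmin; rewrite (decomp_end D).
rewrite (PE p pn) ?in_itv/= ?tps// invgM (AdM hE hG hXi).
apply: (le_trans (upto _ _ (ltnW pn))).
have h : expR (C * t p) * expR (C * (s - t p)) <= expR C.
  rewrite -expRD ler_expR (_ : _ + _ = C * s); last by ring.
  by rewrite ler_piMr.
apply: (le_trans _ (ler_wpM2r (seminorm_ge0 w X) h)).
rewrite -mulrA ler_wpM2l ?expR_ge0//; apply: piece => //.
by rewrite (ltW tps).
Qed.

End Growth.

Lemma bounded_tame (phi : nat -> R -> E) : submultiplicative Xi ->
  (forall w, exists2 C : R, 0 <= C & forall n t, 0 <= t <= 1 -> w (phi n t) <= C) ->
  tame A Xi phi.
Proof.
move=> hsub phiB v; have [w [vw hw]] := hsub v; have [C C0 phiC] := phiB w.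
have [q qE] := scaled_seminorm w (expR_ge0 C).
exists q; split.
  move=> X; rewrite qE; apply: (le_trans (vw X)).
  by rewrite ler_peMl ?seminorm_ge0// -expR0 ler_expR.
move=> n t; rewrite in_itv => t01 X; apply: (le_trans (vw _)); rewrite qE.
by apply: DP0_prod_int_bound => // s; exact: phiC.
Qed.

End ProductIntegral.

(** * Line segments in the chart around the unit *)

Section Lines.
Context {R : realType} {E : tvsType R} {G : preTopologicalGroupType}.
Variables (A : set (chart G E)) (Xi : chart G E).
Hypotheses (hE : hausdorff_space E) (hG : is_lie_group A) (hXi : is_unit_chart A Xi).
Implicit Types (g h : G) (X Y Z x y v : E) (p : cont_seminorm E).

Local Notation aX := (admissible_Xi A Xi).
Local Notation C2_map_at := (C2_map_at A Xi).

Lemma unit_chart_convex : convex_set (cimg Xi).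
Proof. by case: hXi. Qed.

Lemma C2_map_bwd x : cimg Xi x -> C2_map_at (cbwd Xi) x.
Proof. by move=> ix; apply: (C2_map_at_cbwd hE hG hXi); [exact: aX | exact: ix]. Qed.

(** Its derivative in the first argument along the diagonal is the right
    logarithmic derivative read in the chart. *)
Definition chart_quot (z : E * E) : E := cfwd Xi (cbwd Xi z.1 * (cbwd Xi z.2)^-1)%g.

Lemma chart_quot_C2 x : cimg Xi x -> C2_at chart_quot (x, x).
Proof.
move=> ix.
apply: (C2_map_chart (A := A) (f := fun z : E * E => (cbwd Xi z.1 * (cbwd Xi z.2)^-1)%g)).
  apply: (C2_map_at_mul hE hG hXi).
    apply: (C2_map_at_comp (f := @fst E E) (g := cbwd Xi)); first exact: C2_at_fst.
    exact: C2_map_bwd.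
  apply: (C2_map_at_inv hE hG hXi).
  apply: (C2_map_at_comp (f := @snd E E) (g := cbwd Xi)); first exact: C2_at_snd.
  exact: C2_map_bwd.
by rewrite /= mulgV; exact: (Xi_dom1 hXi).
Qed.

(** The right logarithmic derivative at [x] of a curve in the chart with velocity
    [v]. *)
Definition rlog_chart (z : E * E) : E := dderive chart_quot (z.1, z.1) (z.2, 0).

Local Notation omega := rlog_chart.

Lemma rlog_chart_strict x v w : cimg Xi x ->
  exists l, strict_deriv omega (x, v) w l.
Proof.
move=> ix.
have [_ /(_ (v, 0) ((w.1, w.1), (w.2, 0)))[l hl]] :=
  nbhs_singleton (C2_at_dderive hE (chart_quot_C2 ix)).
exists l; pose k (z : E * E) : (E * E) * (E * E) := ((z.1, z.1), (z.2, 0)).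
have kd u : strict_deriv k (x, v) u ((u.1, u.1), (u.2, 0)).
  apply: strict_deriv_pair.
    by apply: strict_deriv_pair; exact: (strict_deriv_fst (x, v) u).
  apply: strict_deriv_pair; last exact: strict_deriv_cst.
  exact: (strict_deriv_snd (x, v) u).
have kC : {for (x, v), continuous k} by exact: strict_deriv_continuous (kd 0).
exact: (strict_deriv_comp kC (kd w) hl).
Qed.

Lemma rlog_chart_continuous x v : cimg Xi x -> {for (x, v), continuous omega}.
Proof. by move=> ix; have [l] := rlog_chart_strict v 0 ix; exact: strict_deriv_continuous. Qed.

Lemma rlog_chart0 v : omega (0, v) = v.
Proof.
have [h _] := nbhs_singleton (C2_at_dderive hE (chart_quot_C2 (Xi_img0 hXi))).
have := strict_deriv_comp (inl_continuous (0 : E) (0 : E)) (strict_deriv_inl 0 v 0) (h (v, 0)).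
move=> /(strict_deriv_unique hE); apply.
apply: strict_deriv_near (strict_deriv_id 0 v).
apply: filterS (near_cimg hG hXi aX (Xi_img0 hXi)) => y cy /=.
by rewrite /chart_quot /= (Xi_bwd0 hG hXi) invg1 mulg1 (chart_cbwdK hG hXi aX).
Qed.

Definition line_curve (a : R) X (s : R^o) : G := cbwd Xi ((s - a) *: X).

Lemma line_C2 (a : R) X (s : R^o) : C2_at (fun s : R^o => (s - a) *: X) s.
Proof.
apply: (C2_at_affine (g := fun t : R^o => t *: X)).
- by move=> y w t; rewrite scalerA -scalerDl addrAC.
- by move=> y w t; rewrite scalerDl scalerA.
- by move=> y; apply: tvs_cvgZ; [exact: cvg_id | exact: cvg_cst].
Qed.

Lemma line_C2_map (a : R) X (t : R^o) : cimg Xi ((t - a) *: X) ->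
  C2_map_at (line_curve a X) t.
Proof.
move=> it; apply: (C2_map_at_comp (f := fun s : R^o => (s - a) *: X) (g := cbwd Xi)).
  exact: line_C2.
exact: C2_map_bwd.
Qed.

Lemma line_regular (a : R) X (t : R^o) : cimg Xi ((t - a) *: X) ->
  regular_at A Xi (line_curve a X) t.
Proof.
move=> it; have [lC lS] := line_C2_map it; split => //.
have [Ac ct] := chart_atP Xi hG (line_curve a X t).
have [h _] := nbhs_singleton (C2_at_dderive hE (lS _ (or_introl Ac) ct)).
exact: h.
Qed.

Lemma line_rlogder (a : R) X (t : R^o) : cimg Xi ((t - a) *: X) ->
  rlogder A Xi (line_curve a X) t = omega ((t - a) *: X, X).
Proof.
move=> it; have h := rlogder_strict hE hG hXi (line_regular it).
apply: (strict_deriv_unique hE h).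
have [h1 _] := nbhs_singleton (C2_at_dderive hE (chart_quot_C2 it)).
pose k (s : R^o) : (E * E)%type := ((s - a) *: X, (t - a) *: X).
have kd u : strict_deriv k t u (u *: X, 0).
  apply: strict_deriv_pair; last exact: strict_deriv_cst.
  apply: (strict_deriv_affine (g := fun t : R^o => t *: X)).
    by move=> y w s; rewrite scalerA -scalerDl addrAC.
  by apply: tvs_cvgZ; [exact: cvg_id | exact: cvg_cst].
have kC : {for t, continuous k} by exact: strict_deriv_continuous (kd 0).
have := strict_deriv_comp kC (kd 1) (h1 _); rewrite scale1r; exact.
Qed.

(** Convexity of the image of the chart makes the set of admissible times an
    interval, and it is open, so the curve extends beyond the end points. *)
Lemma line_Ck_ext (a b c : R) X : a <= b ->
  cimg Xi ((a - c) *: X) -> cimg Xi ((b - c) *: X) ->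
  Ck_ext_G A (Some 1%N) a b (line_curve c X).
Proof.
move=> ab ia ib; pose I := [set t : R | cimg Xi ((t - c) *: X)].
have Io : open I.
  rewrite openE => t It; rewrite /interior.
  have hC := C2_at_continuous (line_C2 c X t).
  exact: (hC _ (near_cimg hG hXi aX It)).
have Ic : is_interval I.
  move=> x y Ix Iy z /andP[xz zy]; have [xy|xy] := eqVneq x y.
    by have -> : z = x by apply/eqP; rewrite eq_le {1}xy zy xz.
  have xy0 : 0 < y - x by rewrite subr_gt0 lt_neqAle xy (le_trans xz).
  have yx0 : y - x != 0 by rewrite gt_eqF.
  rewrite /I /= (_ : (z - c) *: X = ((y - z) / (y - x)) *: ((x - c) *: X) +
      ((z - x) / (y - x)) *: ((y - c) *: X)).
    apply: convex_setP => //; first exact: unit_chart_convex.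
    - by apply: divr_ge0; [rewrite subr_ge0 | exact: ltW].
    - by apply: divr_ge0; [rewrite subr_ge0 | exact: ltW].
    - by field.
  by rewrite !scalerA -scalerDl; congr (_ *: _); field.
exists I; split => //.
  by move=> t; rewrite /= in_itv /= => tab; exact: (Ic a b).
have lC t : I t -> {for (t : R^o), continuous (line_curve c X : R^o -> G)}.
  by move=> It; have [] := line_C2_map It.
split=> [t It|k d]; first exact: lC.
rewrite /line_atlas /= => -> Ad; rewrite /= setIT image_id.
have ad : admissible A Xi d by left.
apply: strict_deriv_Ck_on1.
  rewrite openE => t [It dt]; rewrite /interior.
  have h1 : \forall s \near (t : R^o), I s by exact: open_nbhs_nbhs.
  have h2 := near_cdom_comp hG hXi ad (lC t It) dt.
  by apply: filterS2 h1 h2.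
move=> t v [It dt]; have [_ lS] := line_C2_map It.
have [h _] := nbhs_singleton (C2_at_dderive hE (lS _ ad dt)).
exact: h.
Qed.

Lemma line_integrable (a b c : R) X : a <= b ->
  cimg Xi ((a - c) *: X) -> cimg Xi ((b - c) *: X) ->
  integrable_on A Xi a b (rlogder A Xi (line_curve c X)).
Proof. by move=> ab ia ib; exists (line_curve c X); split => //; exact: line_Ck_ext. Qed.

(** [g] is joined to the unit by a segment in the chart, whose logarithmic
    derivative is at most 1 for [w] if [g] is close to the unit. Compactness of
    [[0, 1]] makes this uniform along the segment. *)
Lemma Ad_locally_bounded (w : cont_seminorm E) :
  (forall X Y, w (bracket Xi X Y) <= w X * w Y) ->
  \forall g \near (1%g : G), forall X, w (Ad Xi g X) <= expR 1 * w X.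
Proof.
move=> hw.
have h01 : compact `[0:R, 1] by exact: segment_compact.
have cov := (compact_near_coveringP _).1 h01 E (nbhs (0 : E))
  (fun x t => cimg Xi (t *: x) /\ w (omega (t *: x, x)) <= 1) _.
have : \forall x \near (0 : E), `[0 : R, 1] `<=`
    (fun t => cimg Xi (t *: x) /\ w (omega (t *: x, x)) <= 1).
  apply: cov => t _.
  have c1 : (fun z : R * E => z.1 *: z.2) @ (t, 0 : E) --> (0 : E).
    rewrite -[X in _ --> X](scaler0 _ t).
    by apply: tvs_cvgZ; [exact: cvg_fst | exact: cvg_snd].
  have c2 : (fun z : R * E => (z.1 *: z.2, z.2)) @ (t, 0 : E) --> ((0, 0) : E * E).
    exact: (cvg_to_prod (G := nbhs (0 : E)) (H := nbhs (0 : E)) c1 cvg_snd).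
  have c3 : (fun z : R * E => omega (z.1 *: z.2, z.2)) @ (t, 0 : E) --> (0 : E).
    have := @rlog_chart_continuous 0 0 (Xi_img0 hXi).
    rewrite /prop_for /continuous_at rlog_chart0 => h; exact: (cvg_comp _ _ c2 h).
  have n1 : \forall z \near (t, 0 : E), cimg Xi (z.1 *: z.2).
    exact: (c1 _ (near_cimg hG hXi aX (Xi_img0 hXi))).
  have n2 : \forall z \near (t, 0 : E), w (omega (z.1 *: z.2, z.2)) <= 1.
    have n0 : \forall z \near (t, 0 : E), w (omega (z.1 *: z.2, z.2) - 0) < 1.
      exact: (cvg_seminorm_lt w c3 ltr01).
    by apply: filterS n0 => z; rewrite subr0 => /ltW.
  by apply: filterS2 n1 n2.
move=> hx.
have [_ _ _ cf _] := admissible_chart hG hXi aX.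
have := cf _ (Xi_dom1 hXi); rewrite /prop_for /continuous_at (Xi1 hXi) => /(_ _ hx) hx'.
apply: filterS2 (near_cdom hG hXi aX (Xi_dom1 hXi)) hx' => g dg hg X.
have line (t : R) : 0 <= t <= 1 -> cimg Xi ((t - 0) *: cfwd Xi g) /\
    w (omega ((t - 0) *: cfwd Xi g, cfwd Xi g)) <= 1.
  by move=> t01; rewrite subr0; apply: hg; rewrite /= in_itv.
have := @Ad_gronwall _ _ _ _ _ hE hG hXi w 1 hw ler01 (line_curve 0 (cfwd Xi g)) 0 1 X ler01.
rewrite subr0 mul1r {1 3}/line_curve subr0 scale1r (XiK hG hXi dg).
rewrite {2}/line_curve subrr scale0r (Xi_bwd0 hG hXi) (Ad1 hE hG hXi) => h.
apply: (h _ _).1.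
  by move=> t /line[it _]; exact: line_regular.
move=> t /andP[/ltW t0 /ltW t1]; have [|it wt] := line t; first by rewrite t0 t1.
by rewrite line_rlogder.
Qed.

End Lines.

(** * Approximation of continuous curves *)

Lemma near_compact {T : topologicalType} {I : Type} (K : set T) (F : set_system I)
    {FF : Filter F} (P : I -> T -> Prop) : compact K ->
  (forall x, K x -> \forall x' \near x & i \near F, P i x') ->
  \forall i \near F, forall x, K x -> P i x.
Proof. by move=> /compact_near_coveringP cK h; exact: cK. Qed.

Section Approximation.
Context {R : realType} {E : tvsType R} {G : preTopologicalGroupType}.
Variables (A : set (chart G E)) (Xi : chart G E).
Hypotheses (hE : hausdorff_space E) (hG : is_lie_group A) (hXi : is_unit_chart A Xi).
Variables (psi : R -> E).
Hypothesis psiC : continuous psi.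
Implicit Types (p w : cont_seminorm E) (t s u d e : R).

Local Notation aX := (admissible_Xi A Xi).
Local Notation omega := (rlog_chart Xi).

(** The tube lemma over [[0, 1]]. *)
Lemma uniform_near0 (P : R -> R -> Prop) :
  (forall t, 0 <= t <= 1 -> \forall z \near (t, 0 : R), P z.2 z.1) ->
  exists2 d : R, 0 < d & forall t s, 0 <= t <= 1 -> `|s| < d -> P s t.
Proof.
move=> h; have h01 : compact `[0:R, 1] by exact: segment_compact.
have := (compact_near_coveringP _).1 h01 R (nbhs (0 : R)) P _.
case.
  move=> t; rewrite /= in_itv /= => t01; exact: h.
move=> d /= d0 hd; exists d => // t s t01 sd.
by apply: (hd s); rewrite /= ?sub0r ?normrN// in_itv.
Qed.

Lemma psi_fst_cvg (t s : R) : (fun z : R * R => psi z.1) @ (t, s) --> psi t.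
Proof.
have c0 : (@fst R R) @ (t, s) --> t by exact: cvg_fst.
exact: (cvg_comp _ _ c0 (psiC (x := t))).
Qed.

Lemma line_cvg0 (t : R) : (fun z : R * R => z.2 *: psi z.1) @ (t, 0 : R) --> (0 : E).
Proof.
rewrite -[X in _ --> X](scale0r (psi t)).
have c1 : (fun z : R * R => psi z.1) @ (t, 0 : R) --> psi t.
  exact: psi_fst_cvg.
have c2 : (fun z : R * R => z.2) @ (t, 0 : R) --> (0 : R) by exact: cvg_snd.
exact: tvs_cvgZ c2 c1.
Qed.

Lemma lines_in_chart : exists2 d : R, 0 < d &
  forall t s, 0 <= t <= 1 -> `|s| < d -> cimg Xi (s *: psi t).
Proof.
apply: (uniform_near0 (P := fun s t => cimg Xi (s *: psi t))) => t _.
exact: (@line_cvg0 t _ (near_cimg hG hXi aX (Xi_img0 hXi))).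
Qed.

Lemma omega_line_cvg (t s : R) : cimg Xi (s *: psi t) ->
  (fun z : R * R => omega (z.2 *: psi z.1, psi z.1)) @ (t, s) -->
  omega (s *: psi t, psi t).
Proof.
move=> it; have c1 := @psi_fst_cvg t s.
have c2 : (fun z : R * R => z.2) @ (t, s) --> s by exact: cvg_snd.
have c3 : (fun z : R * R => z.2 *: psi z.1) @ (t, s) --> s *: psi t.
  exact: tvs_cvgZ c2 c1.
have c4 : (fun z : R * R => (z.2 *: psi z.1, psi z.1)) @ (t, s) --> (s *: psi t, psi t).
  exact: (cvg_to_prod (G := nbhs (s *: psi t)) (H := nbhs (psi t)) c3 c1).
exact: (cvg_comp _ _ c4 (@rlog_chart_continuous _ _ _ _ _ hE hG hXi _ _ it)).
Qed.

Lemma omega_near_uniform p (e : R) : 0 < e -> exists2 d : R, 0 < d &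
  forall t s, 0 <= t <= 1 -> `|s| < d -> p (omega (s *: psi t, psi t) - psi t) < e.
Proof.
move=> e0.
apply: (uniform_near0 (P := fun s t => p (omega (s *: psi t, psi t) - psi t) < e)) => t _.
have i0 : cimg Xi (0 *: psi t) by rewrite scale0r; exact: (Xi_img0 hXi).
have c1 := omega_line_cvg i0; rewrite scale0r (rlog_chart0 hE hG hXi) in c1.
have c2 : (fun z : R * R => omega (z.2 *: psi z.1, psi z.1) - psi z.1) @ (t, 0 : R)
    --> (0 : E).
  by rewrite -(subrr (psi t)); apply: tvs_cvgB; [exact: c1 | exact: psi_fst_cvg].
have n0 : \forall z \near (t, 0 : R),
    p (omega (z.2 *: psi z.1, psi z.1) - psi z.1 - 0) < e.
  exact: (cvg_seminorm_lt p c2 e0).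
by apply: filterS n0 => z; rewrite subr0.
Qed.

Lemma psi_uniform p (e : R) : 0 < e -> exists2 d : R, 0 < d &
  forall t s, 0 <= t <= 1 -> `|s| < d -> p (psi (t + s) - psi t) < e.
Proof.
move=> e0.
apply: (uniform_near0 (P := fun s t => p (psi (t + s) - psi t) < e)) => t _.
have c0 : (fun z : R * R => z.1 + z.2) @ (t, 0 : R) --> t.
  rewrite -[X in _ --> X]addr0.
  by apply: (@tvs_cvgD R R^o); [exact: cvg_fst | exact: cvg_snd].
have c2 : (fun z : R * R => psi (z.1 + z.2) - psi z.1) @ (t, 0 : R) --> (0 : E).
  rewrite -(subrr (psi t)); apply: tvs_cvgB; last exact: psi_fst_cvg.
  exact: (cvg_comp _ _ c0 (psiC (x := t))).
have n0 : \forall z \near (t, 0 : R), p (psi (z.1 + z.2) - psi z.1 - 0) < e.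
  exact: (cvg_seminorm_lt p c2 e0).
by apply: filterS n0 => z; rewrite subr0.
Qed.

(** For a fixed step size all seminorms must be bounded over the same set of times,
    hence the compact rectangle instead of a neighbourhood of [s = 0]. *)
Lemma omega_bounded w (d : R) :
  (forall t s, 0 <= t <= 1 -> 0 <= s <= d -> cimg Xi (s *: psi t)) ->
  exists2 C : R, 0 <= C & forall t s, 0 <= t <= 1 -> 0 <= s <= d ->
    w (omega (s *: psi t, psi t)) <= C.
Proof.
move=> hd; have cK : compact (`[0:R, 1] `*` `[0:R, d]).
  by apply: compact_setX; exact: segment_compact.
have h1 (z : R * R) : (`[0:R, 1] `*` `[0:R, d]) z ->
   \forall z' \near z & C \near +oo, w (omega (z'.2 *: psi z'.1, psi z'.1)) <= C.
  case: z => t s /= []; rewrite !in_itv /= => t01 s0d.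
  have c1 := omega_line_cvg (hd t s t01 s0d).
  set l := omega _ in c1.
  have n1 : \forall z' \near (t, s), w (omega (z'.2 *: psi z'.1, psi z'.1) - l) < 1.
    exact: (cvg_seminorm_lt w c1 ltr01).
  exists ([set z' | w (omega (z'.2 *: psi z'.1, psi z'.1) - l) < 1],
          [set C | w l + 1 <= C]); first by split => //=; apply: nbhs_pinfty_ge; exact: num_real.
  move=> [z' C] /= [h1 h2]; apply: (le_trans _ h2).
  by apply: (le_trans (seminorm_lerB w _ l)); rewrite lerD2l ltW.
have [C [_ hC]] : \forall C \near +oo, forall z : R * R,
    (`[0:R, 1] `*` `[0:R, d]) z -> w (omega (z.2 *: psi z.1, psi z.1)) <= C.
  exact: (near_compact cK h1).
exists (Num.max 0 (C + 1)); first by rewrite le_max lexx.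
move=> t s t01 s0d; have K : (`[0:R, 1] `*` `[0:R, d]) (t, s).
  by rewrite /= !in_itv /=.
have C1 : C < C + 1 by rewrite ltrDl.
by apply: (le_trans (hC _ C1 (t, s) K)); rewrite le_max lexx orbT.
Qed.

(** Strict differentiability of [omega] at [(0, psi t)] in the direction
    [(psi t, 0)] bounds the quotient locally; covering [[0, 1]] chooses the constant
    [c] and the radius together, as a limit along [+oo] and 0. *)
Lemma omega_lipschitz p : exists2 c : R, 0 <= c & exists2 d : R, 0 < d &
  forall t s, 0 <= t <= 1 -> `|s| < d ->
    p (omega (s *: psi t, psi t) - psi t) <= c * `|s|.
Proof.
have h01 : compact `[0:R, 1] by exact: segment_compact.
have h1 (t : R) : [set` `[0:R, 1]] t ->
   \forall t' \near t & z \near filter_prod (pinfty_nbhs R) (nbhs (0 : R)),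
     p (omega (z.2 *: psi t', psi t') - psi t') <= z.1 * `|z.2|.
  move=> _.
  have [l hl] := @rlog_chart_strict _ _ _ _ _ hE hG hXi 0 (psi t) (psi t, 0) (Xi_img0 hXi).
  have [[P Q] /= [PP Q0] PQ] := cvg_seminorm_lt p hl ltr01.
  have ck : (fun t' => ((0, psi t'), (psi t', 0)) : (E * E) * (E * E)) @ t -->
      ((0, psi t), (psi t, 0)).
    apply: (cvg_to_prod (G := nbhs (0 : E, psi t)) (H := nbhs (psi t, 0 : E))).
      exact: (cvg_to_prod (G := nbhs (0 : E)) (H := nbhs (psi t)) (cvg_cst _) (psiC (x := t))).
    exact: (cvg_to_prod (G := nbhs (psi t)) (H := nbhs (0 : E)) (psiC (x := t)) (cvg_cst _)).
  have n1 : \forall t' \near t, P ((0, psi t'), (psi t', 0)) by exact: (ck _ PP).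
  have [d /= d0 hd] := Q0.
  exists ([set t' | P ((0, psi t'), (psi t', 0))],
          [set z | p l + 1 <= z.1 /\ `|z.2| < d]).
    split => //=; exists ([set c | p l + 1 <= c], [set s | `|s| < d]) => //=.
      split; first by apply: nbhs_pinfty_ge; exact: num_real.
      by exists d => // s /=; rewrite sub0r normrN.
  move=> [t' [c s]] /= [Pt' [lc sd]].
  have [->|s0] := eqVneq s 0.
    by rewrite scale0r (rlog_chart0 hE hG hXi) subrr seminorm0 normr0 mulr0.
  have Qs : Q s by apply: hd => //=; rewrite sub0r normrN.
  have := PQ (((0, psi t'), (psi t', 0)), s) (conj Pt' Qs).
  rewrite /=; set q := diff_quot _ _ _ _ => hq.
  have -> : omega (s *: psi t', psi t') - psi t' = s *: q.
    rewrite /q /diff_quot scalerA divff// scale1r (rlog_chart0 hE hG hXi).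
    congr (omega _ - _); congr (_, _); first by rewrite /= add0r.
    by rewrite /= scaler0 addr0.
  rewrite seminormZ mulrC ler_wpM2r//; apply: (le_trans _ lc).
  by apply: (le_trans (seminorm_lerB p q l)); rewrite lerD2l ltW.
have [[P Q] /= [[c0 [_ hc0]] [d /= d0 hd]] PQ] :
    \forall z \near filter_prod (pinfty_nbhs R) (nbhs (0 : R)), forall t : R,
      [set` `[0:R, 1]] t -> p (omega (z.2 *: psi t, psi t) - psi t) <= z.1 * `|z.2|.
  exact: (near_compact h01 h1).
exists (Num.max 0 (c0 + 1)); first by rewrite le_max lexx.
exists d => // t s t01 sd.
have Pc : P (Num.max 0 (c0 + 1)) by apply: hc0; rewrite lt_max ltrDl ltr01 orbT.
have Qs : Q s by apply: hd => //=; rewrite sub0r normrN.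
by apply: (PQ (_, s) (conj Pc Qs)); rewrite /= in_itv.
Qed.

(** On the piece that starts at the node [u] the approximation is the logarithmic
    derivative of the line [s |-> Xi^-1 (s psi u)]. The mesh starts below the
    radius [d] within which all these lines stay in the chart, so that every member
    of the sequence is defined and the bounds hold for all indices. *)
Lemma approximating_sequence : exists phi : nat -> R -> E,
  [/\ forall n, DP0 A Xi (phi n),
      forall w, exists2 C : R, 0 <= C & forall n t, 0 <= t <= 1 -> w (phi n t) <= C &
      forall n t, 0 <= t <= 1 -> exists u s : R,
        [/\ 0 <= u <= 1, 0 <= s < n.+1%:R^-1, t = u + s &
            phi n t = omega (s *: psi u, psi u)]].
Proof.
have [d d0 hd] := lines_in_chart.
(* [n0] makes even the coarsest mesh [1 / (n0 + 1)] smaller than [d]. *)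
pose n0 := Num.truncn d^-1.
pose N n : nat := (n + n0).+1.
have N0 n : 0 < (N n)%:R :> R by rewrite ltr0n.
have Nd n : (N n)%:R^-1 < d.
  rewrite invf_plt ?posrE//; apply: (lt_le_trans (truncnS_gt _)).
  by rewrite ler_nat ltnS leq_addl.
pose node n t : R := (Num.truncn (t * (N n)%:R))%:R / (N n)%:R.
pose phi n t := omega ((t - node n t) *: psi (node n t), psi (node n t)).
have nodeP n t : 0 <= t <= 1 ->
    [/\ 0 <= node n t <= 1 & 0 <= t - node n t < (N n)%:R^-1].
  move=> /andP[t0 t1].
  have /andP[h1 h2] := truncn_itv (mulr_ge0 t0 (ltW (N0 n))).
  have nt : node n t <= t by rewrite /node ler_pdivrMr.
  split; first by rewrite (le_trans nt t1) andbT divr_ge0.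
  rewrite subr_ge0 nt /= ltrBlDr -div1r -mulrDl ltr_pdivlMr//.
  by rewrite addrC natr1.
exists phi; split.
- move=> n; exists (N n), (fun i : nat => i%:R / (N n)%:R),
    (fun i : nat =>
      rlogder A Xi (line_curve Xi (i%:R / (N n)%:R) (psi (i%:R / (N n)%:R)))).
  have knot i : (i <= N n)%N -> 0 <= (i%:R / (N n)%:R : R) <= 1.
    by move=> pn; rewrite divr_ge0//= ler_pdivrMr// mul1r ler_nat.
  have step i : i.+1%:R / (N n)%:R - i%:R / (N n)%:R = (N n)%:R^-1 :> R.
    by rewrite -mulrBl -natrB// subSnn div1r.
  split.
  + by rewrite mul0r.
  + by rewrite divff// gt_eqF.
  + by move=> p pn; rewrite ltr_pM2r ?invr_gt0// ltr_nat.
  + move=> p pn; apply: (line_integrable hE hG hXi).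
    * by rewrite ler_pM2r ?invr_gt0// ler_nat.
    * by rewrite subrr scale0r; exact: (Xi_img0 hXi).
    * by rewrite step; apply: hd; [exact: knot (ltnW pn) | rewrite gtr0_norm ?invr_gt0].
  + move=> p pn s; rewrite in_itv /= => /andP[ps sp].
    have nodeE : node n s = p%:R / (N n)%:R.
      rewrite /node; congr (_%:R / _); apply: truncn_def.
      by rewrite -ler_pdivrMr// (ltW ps) -ltr_pdivlMr.
    rewrite (line_rlogder hE hG hXi); first by rewrite /phi nodeE.
    apply: hd; first exact: knot (ltnW pn).
    rewrite ger0_norm ?subr_ge0 ?ltW//; apply: (le_lt_trans _ (Nd n)).
    by rewrite -[leRHS](step p) lerD2r ltW.
- move=> w; have [C C0 hC] := @omega_bounded w (N 0%N)%:R^-1 (ltac:(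
    by move=> t s t01 /andP[s0 sN]; apply: hd => //; rewrite ger0_norm// (le_lt_trans sN))).
  exists C => // n t t01; have [node01 /andP[s0 sN]] := nodeP n t t01.
  apply: hC => //; rewrite s0 /=; apply: (le_trans (ltW sN)).
  by rewrite lef_pV2 ?posrE// ler_nat /N add0n ltnS leq_addl.
- move=> n t t01; have [node01 /andP[s0 sN]] := nodeP n t t01.
  exists (node n t), (t - node n t); split=> [//||//|//]; last by rewrite addrC subrK.
  rewrite s0 /=; apply: (lt_le_trans sN).
  by rewrite lef_pV2 ?posrE ?ltr0n// ler_nat /N ltnS leq_addr.
Qed.

End Approximation.

(** * Integrability *)

Section UniformNorm.
Context {R : realType} {E : tvsType R}.
Implicit Types (p : cont_seminorm E) (phi psi : R -> E).

Lemma seminorm_sup_le p phi (M : R) :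
  (forall t, 0 <= t <= 1 -> p (phi t) <= M) -> (seminorm_sup p phi <= M%:E)%E.
Proof.
move=> h; apply: ge_ereal_sup => _ [t /= t01 <-]; rewrite lee_fin; apply: h.
by move: t01; rewrite in_itv.
Qed.

Lemma seminorm_sup_ge0 p phi : (0 <= seminorm_sup p phi)%E.
Proof.
apply: (@le_trans _ _ (p (phi 0))%:E); first by rewrite lee_fin seminorm_ge0.
by apply: ereal_sup_ubound; exists 0 => //=; rewrite in_itv /= lexx ler01.
Qed.

Lemma eq_seminorm_sup p phi psi : (forall t, 0 <= t <= 1 -> phi t = psi t) ->
  seminorm_sup p phi = seminorm_sup p psi.
Proof.
move=> h; rewrite /seminorm_sup; congr ereal_sup; apply: eq_imagel => t /=.
by rewrite in_itv /= => /h ->.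
Qed.

Lemma unif_converges_le (phi : nat -> R -> E) psi :
  (forall p (e : R), 0 < e -> exists N, forall n t, (N <= n)%N -> 0 <= t <= 1 ->
     p (psi t - phi n t) <= e) -> unif_converges phi psi.
Proof.
move=> h p; apply/fine_cvgP; split.
  have [N hN] := h p 1 ltr01; exists N => // n /= Nn.
  rewrite ge0_fin_numE ?seminorm_sup_ge0//; apply: le_lt_trans (ltry 1).
  by apply: seminorm_sup_le => t; exact: hN.
apply/cvgrPdist_le => e e0; have [N hN] := h p e e0.
exists N => // n /= Nn; have le_e : (seminorm_sup p (fun t => psi t - phi n t)%R <= e%:E)%E.
  by apply: seminorm_sup_le => t; exact: hN.
have fin : seminorm_sup p (fun t => psi t - phi n t) \is a fin_num.
  by rewrite ge0_fin_numE ?seminorm_sup_ge0//; apply: le_lt_trans (ltry e).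
rewrite sub0r normrN ger0_norm ?fine_ge0 ?seminorm_sup_ge0//.
by rewrite -lee_fin fineK.
Qed.

End UniformNorm.

Section Integrability.
Context {R : realType} {E : tvsType R} {G : preTopologicalGroupType}.
Variables (A : set (chart G E)) (Xi : chart G E).
Hypotheses (hE : hausdorff_space E) (hG : is_lie_group A) (hXi : is_unit_chart A Xi)
  (hsub : submultiplicative Xi).
Implicit Types (p w : cont_seminorm E) (psi phi : R -> E) (t s u d e : R).

Local Notation omega := (rlog_chart Xi).

Lemma continuous_s_integrable psi : continuous psi -> s_integrable A Xi psi.
Proof.
move=> psiC; have [phi [phiD phiB phiE]] := approximating_sequence hE hG hXi psiC.
have err p e : 0 < e -> exists N, forall n t, (N <= n)%N -> 0 <= t <= 1 ->
    p (psi t - phi n t) <= e.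
  move=> e0; have e20 : 0 < e / 2 by rewrite divr_gt0.
  have [d1 d10 h1] := psi_uniform psiC p e20.
  have [d2 d20 h2] := omega_near_uniform hE hG hXi psiC p e20.
  have d0 : 0 < Num.min d1 d2 by rewrite lt_min d10.
  exists (Num.truncn (Num.min d1 d2)^-1) => n t Nn t01.
  have [u [s [u01 /andP[s0 sn] -> ->]]] := phiE n t t01.
  have sd : s < Num.min d1 d2.
    apply: (lt_trans sn); rewrite invf_plt ?posrE ?ltr0n//.
    by apply: (lt_le_trans (truncnS_gt _)); rewrite ler_nat ltnS.
  move: sd; rewrite lt_min => /andP[sd1 sd2].
  have ns : `|s| = s by rewrite ger0_norm.
  have := h1 u s u01; rewrite ns => /(_ sd1) k1.
  have := h2 u s u01; rewrite ns => /(_ sd2); rewrite seminorm_distC => k2.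
  apply: (le_trans (seminorm_dist3 p (psi u) _ _)).
  by rewrite [leRHS]splitr lerD// ltW.
exists phi; split => //.
- exact: bounded_tame phiB.
- move=> p e e0; have e20 : 0 < e / 2 by rewrite divr_gt0.
  have [N hN] := err p _ e20; exists N => m n Nm Nn.
  apply: seminorm_sup_le => t t01.
  apply: (le_trans (seminorm_dist3 p (psi t) _ _)).
  by rewrite [leRHS]splitr lerD// ?hN// seminorm_distC hN.
- exact: unif_converges_le.
Qed.

(** The error [(L + c) / n.+1] is the product of a constant that depends on the
    seminorm and a rate that does not, as a Mackey-Cauchy sequence requires. *)
Lemma lipschitz_m_integrable psi : continuous psi ->
  (forall p, exists2 L : R, 0 <= L & forall t s, p (psi t - psi s) <= L * `|t - s|) ->
  m_integrable A Xi psi.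
Proof.
move=> psiC psiL; have [phi [phiD phiB phiE]] := approximating_sequence hE hG hXi psiC.
have err p : exists cl : R * nat, 0 <= cl.1 /\ forall n t, (cl.2 <= n)%N -> 0 <= t <= 1 ->
    p (psi t - phi n t) <= cl.1 * n.+1%:R^-1.
  have [L L0 hL] := psiL p.
  have [c c0 [d d0 hd]] := omega_lipschitz hE hG hXi psiC p.
  exists (L + c, Num.truncn d^-1); split; first by rewrite addr_ge0.
  move=> n t /= Nn t01.
  have [u [s [u01 /andP[s0 sn] -> ->]]] := phiE n t t01.
  have sd : `|s| < d.
    rewrite ger0_norm//; apply: (lt_trans sn); rewrite invf_plt ?posrE ?ltr0n//.
    by apply: (lt_le_trans (truncnS_gt _)); rewrite ler_nat ltnS.
  have k1 := hL (u + s) u; have k2 := hd u s u01 sd.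
  rewrite (_ : u + s - u = s) in k1; last by rewrite addrAC subrr add0r.
  rewrite seminorm_distC in k2.
  apply: (le_trans (seminorm_dist3 p (psi u) _ _)).
  apply: (le_trans (lerD k1 k2)); rewrite -mulrDl ler_wpM2l ?addr_ge0//.
  by rewrite ger0_norm// ltW.
have [cl hcl] := choice err.
exists phi; split => //.
- exact: bounded_tame phiB.
- exists (fun p => (cl p).1), (fun p => (cl p).2),
    (fun m n => m.+1%:R^-1 + n.+1%:R^-1); split.
  + by move=> p; have [] := hcl p.
  + by move=> m n; rewrite addr_ge0// invr_ge0.
  + rewrite -[X in _ --> X]addr0; apply: (@tvs_cvgD R R^o).
      exact: (cvg_comp _ _ cvg_fst (@cvg_harmonic R)).
    exact: (cvg_comp _ _ cvg_snd (@cvg_harmonic R)).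
  + move=> p m n lm ln; have [c0 hp] := hcl p.
    apply: seminorm_sup_le => t t01.
    apply: (le_trans (seminorm_dist3 p (psi t) _ _)).
    by rewrite mulrDr lerD// ?hp// seminorm_distC hp.
- apply: unif_converges_le => p e e0; have [c0 hp] := hcl p.
  exists (maxn (cl p).2 (Num.truncn ((cl p).1 / e))) => n t.
  rewrite geq_max => /andP[ln tn] t01; apply: (le_trans (hp n t ln t01)).
  rewrite ler_pdivrMr ?ltr0n// mulrC -ler_pdivrMr// ltW//.
  by apply: (lt_le_trans (truncnS_gt _)); rewrite ler_nat ltnS.
Qed.

Definition clamp t : R := if t <= 0 then 0 else if 1 <= t then 1 else t.

Lemma clamp01 t : 0 <= clamp t <= 1.
Proof.
rewrite /clamp; have [t0|/ltW t0] := leP t 0; first by rewrite lexx ler01.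
by have [t1|/ltW t1] := leP 1 t; rewrite ?ler01 ?lexx ?t0.
Qed.

Lemma clampE t : 0 <= t <= 1 -> clamp t = t.
Proof.
rewrite /clamp => /andP[t0 t1]; case: ifP => [t0'|_].
  by apply/eqP; rewrite eq_le t0 t0'.
by case: ifP => [t1'|//]; apply/eqP; rewrite eq_le t1 t1'.
Qed.

Lemma clamp_dist t s : `|clamp t - clamp s| <= `|t - s|.
Proof.
wlog ts : t s / t <= s.
  move=> h; have [|/ltW] := leP t s; first exact: h.
  by move=> /h; rewrite distrC [X in _ <= X]distrC.
have mono : 0 <= clamp s - clamp t <= s - t.
  by rewrite /clamp; case: (leP t 0) => ?; case: (leP s 0) => ?;
    case: (leP 1 t) => ?; case: (leP 1 s) => ?; apply/andP; split; lra.
case/andP: mono => h1 h2; rewrite distrC ger0_norm//.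
by rewrite distrC ger0_norm ?subr_ge0.
Qed.

Lemma clamp_continuous : continuous clamp.
Proof.
move=> t; apply/cvgrPdist_lt => e e0; exists e => //= s /= h.
exact: (le_lt_trans (clamp_dist _ _)).
Qed.

Lemma s_integrable_eq psi phi : (forall t, 0 <= t <= 1 -> phi t = psi t) ->
  s_integrable A Xi psi -> s_integrable A Xi phi.
Proof.
move=> h [f [f1 f2 f3 f4]]; exists f; split => // p.
have -> : (fun n => seminorm_sup p (fun t => phi t - f n t)) =
  (fun n => seminorm_sup p (fun t => psi t - f n t)); last exact: f4.
by apply/funext => n; apply: eq_seminorm_sup => t t01; rewrite h.
Qed.

Lemma m_integrable_eq psi phi : (forall t, 0 <= t <= 1 -> phi t = psi t) ->
  m_integrable A Xi psi -> m_integrable A Xi phi.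
Proof.
move=> h [f [f1 f2 f3 f4]]; exists f; split => // p.
have -> : (fun n => seminorm_sup p (fun t => phi t - f n t)) =
  (fun n => seminorm_sup p (fun t => psi t - f n t)); last exact: f4.
by apply/funext => n; apply: eq_seminorm_sup => t t01; rewrite h.
Qed.

(** Composing with [clamp] turns the curve into a continuous function on the whole
    line without changing it on [[0, 1]]. *)
Lemma C0_curve_s_integrable phi : Ck_curve (Some 0%N) 0 1 phi -> s_integrable A Xi phi.
Proof.
move=> [I [psi [Io _ I01 [_ psiC] phiE]]].
apply: (@s_integrable_eq (psi \o clamp)).
  by move=> t t01; rewrite /= clampE// phiE// in_itv.
apply: continuous_s_integrable => t.
apply: continuous_comp; first exact: clamp_continuous.
have It : I (clamp t) by apply: I01; rewrite /= in_itv; exact: clamp01.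
have := psiC 0%N isT (clamp t) (fun=> 0) It; rewrite enum_ord0 /= => h.
have c1 : (fun x : R^o => (x, (fun=> 0) : {ptws 'I_0 -> R^o})) @ (clamp t : R^o) -->
   (clamp t : R^o, (fun=> 0) : {ptws 'I_0 -> R^o}).
  by apply: cvg_to_prod; [exact: cvg_id | exact: cvg_cst].
exact: (cvg_comp _ _ c1 h).
Qed.

Lemma lip_curve_m_integrable phi : lip_curve 0 1 phi -> m_integrable A Xi phi.
Proof.
move=> phiL; apply: (@m_integrable_eq (phi \o clamp)).
  by move=> t t01; rewrite /= clampE.
have L p : exists2 L : R, 0 <= L &
    forall t s, p ((phi \o clamp) t - (phi \o clamp) s) <= L * `|t - s|.
  have [L L0 hL] := phiL p; exists L => // t s /=.
  apply: (le_trans (hL _ _ _ _)); rewrite ?in_itv ?clamp01//=.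
  by rewrite ler_wpM2l// clamp_dist.
apply: lipschitz_m_integrable => // t; apply: seminorm_cvg => p e e0.
have [K K0 hK] := L p.
have K1 : 0 < K + 1 by rewrite ltr_pwDr.
exists (e / (K + 1)); first by rewrite /= divr_gt0.
move=> s /=; rewrite distrC ltr_pdivlMr// mulrC => h.
by apply: (le_lt_trans (hK s t)); apply: (le_lt_trans _ h); rewrite ler_wpM2r// lerDl.
Qed.

(** The derivative is continuous, hence bounded on the compact interval, for each
    seminorm. *)
Lemma C1_curve_lip k phi : le_order 1 k -> Ck_curve k 0 1 phi -> lip_curve 0 1 phi.
Proof.
move=> k1 [I [psi [Io _ I01 psiCk phiE]]] p.
have sd t v : I t -> strict_deriv (psi : R^o -> E) t v (dderive psi t v).
  by move=> It; apply: (Ck_on_strict_deriv k1 _ psiCk); exact: open_nbhs_nbhs.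
have dC t : I t -> (fun s : R => dderive psi s 1) @ t --> dderive psi t 1.
  move=> It.
  have near_sd : \forall s \near (t : R^o), forall v,
      strict_deriv (psi : R^o -> E) s v (dderive psi s v).
    have h : \forall s \near (t : R^o), I s by exact: open_nbhs_nbhs.
    by apply: filterS h => s Is v; exact: sd.
  have h := @strict_deriv_contD _ _ _ psi (dderive psi) t 1 near_sd.
  exact: (cvg_comp _ _ (inl_continuous (t : R^o) (1 : R^o)) h).
have h01 : compact `[0:R, 1] by exact: segment_compact.
have [C [_ hC]] : \forall C \near +oo, forall t : R, [set` `[0:R, 1]] t ->
    p (dderive psi t 1) <= C.
  apply: (near_compact h01) => t t01; have It : I t by exact: I01.
  have n1 : \forall s \near t, p (dderive psi s 1 - dderive psi t 1) < 1.
    exact: (cvg_seminorm_lt p (dC t It) ltr01).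
  exists ([set s | p (dderive psi s 1 - dderive psi t 1) < 1],
          [set C | p (dderive psi t 1) + 1 <= C]).
    by split => //=; apply: nbhs_pinfty_ge; exact: num_real.
  move=> [s C] /= [h1 h2]; apply: (le_trans _ h2).
  by apply: (le_trans (seminorm_lerB p _ (dderive psi t 1))); rewrite lerD2l ltW.
have C1 : C < C + 1 by rewrite ltrDl.
exists (Num.max 0 (C + 1)); first by rewrite le_max lexx.
have main t s : t <= s -> t \in `[0, 1] -> s \in `[0, 1] ->
    p (psi s - psi t) <= Num.max 0 (C + 1) * (s - t).
  move=> ts; rewrite !in_itv /= => /andP[t0 t1] /andP[s0 s1].
  have in01 u : t <= u <= s -> [set` `[0:R, 1]] u.
    by move=> /andP[tu us]; rewrite /= in_itv /= (le_trans t0 tu) (le_trans us s1).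
  apply: (mean_value_curve (eta := psi)) => // u.
    move=> /in01/I01 Iu; exact: is_dderive_continuous_curve (strict_is_dderive (sd u 1 Iu)).
  move=> /andP[/ltW tu /ltW us]; have u01 := in01 u (ltac:(by rewrite tu us)).
  exists (dderive psi u 1); first exact: strict_is_dderive (sd u 1 (I01 _ u01)).
  by apply: (le_trans (hC _ C1 u u01)); rewrite le_max lexx orbT.
move=> t s t01 s01; rewrite !phiE//; have [ts|/ltW st] := leP t s.
  by rewrite seminorm_distC distrC ger0_norm ?subr_ge0//; exact: main.
by rewrite ger0_norm ?subr_ge0//; exact: main.
Qed.

Lemma submultiplicative_confined k : confined A Xi k.
Proof.
case: k => [[|n]||] phi /=.
- exact: C0_curve_s_integrable.
- by move=> h; apply: lip_curve_m_integrable; exact: C1_curve_lip h.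
- exact: lip_curve_m_integrable.
- by move=> h; apply: lip_curve_m_integrable; exact: C1_curve_lip h.
Qed.

Lemma submultiplicative_Ad_bounded (v : cont_seminorm E) :
  exists (w : cont_seminorm E) (C : R) (V : set G),
     [/\ seminorm_le v w, 0 <= C, open V, V 1%g &
         forall g, V g -> forall X : E, w (Ad Xi g X) <= C * w X].
Proof.
have [w [vw hw]] := hsub v.
exists w, (expR 1), (interior [set g : G | forall X, w (Ad Xi g X) <= expR 1 * w X]).
have C0 : 0 <= expR 1 :> R by exact: expR_ge0.
have V1 := Ad_locally_bounded hE hG hXi hw.
by split => //; [exact: open_interior | move=> g /interior_subset].
Qed.

Lemma submultiplicative_reliable : reliable Xi.
Proof.
move=> v; have [w [C [V [vw C0 Vo V1 hV]]]] := submultiplicative_Ad_bounded v.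
have [q hq] := choice (fun n => scaled_seminorm w (exprn_ge0 n C0)).
exists (V `&` [set g | V (g^-1)%g]), q; split.
- have nV : nbhs (1%g : G) V by exact: open_nbhs_nbhs.
  apply: filterI => //; case: hG => _ _ _ [iC _].
  by have := iC 1%g I; rewrite /prop_for /continuous_at invg1 => h; exact: (h _ nV).
- by move=> g [Vg Vg'] /=; rewrite invgK.
- move=> n g _ Vg X; apply: (le_trans (vw _)); rewrite hq.
  have -> : C ^+ n = C ^+ size [seq g i | i <- enum 'I_n].
    by rewrite size_map size_enum_ord.
  have : forall h, h \in [seq g i | i <- enum 'I_n] -> V h.
    by move=> h /mapP[i _ ->]; have [] := Vg i.
  elim: [seq g i | i <- enum 'I_n] => [|h s IHs] hs /=; first by rewrite expr0 mul1r.
  apply: (le_trans (hV h _ _)); first by apply: hs; rewrite mem_head.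
  rewrite exprS -mulrA ler_wpM2l//; apply: IHs => h' hs'.
  by apply: hs; rewrite in_cons hs' orbT.
Qed.

End Integrability.

Theorem proposition6 (R : realType) (E : tvsType R) (hE : hausdorff_space E)
    (G : preTopologicalGroupType) (A : set (chart G E)) (hG : is_lie_group A)
    (Xi : chart G E) (hXi : is_unit_chart A Xi)
    (hsub : submultiplicative Xi) :
  (forall k : reg_index, confined A Xi k) /\
  reliable Xi /\
  (forall v : cont_seminorm E, exists (w : cont_seminorm E) (C : R) (V : set G),
     [/\ seminorm_le v w, 0 <= C, open V, V 1%g &
         forall g, V g -> forall X : E, w (Ad Xi g X) <= C * w X]).
Proof.
split; first by move=> k; exact: submultiplicative_confined.
split; first exact: (submultiplicative_reliable hE hG hXi hsub).
by move=> v; exact: (submultiplicative_Ad_bounded hE hG hXi hsub v).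
Qed.
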